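(* Let $n$ be an odd positive integer, $r\ge1$, and let $F,S,\mathcal O_S,p,q$, the Gauss sums $g_t(1,p)$, and the coefficients $H^{(n)}(p^{\mathbf k};p^{\boldsymbol\ell})$ be as in the context, where $\boldsymbol\ell=(\ell_1,\dots,\ell_r)$ is a tuple of nonnegative integers, and let $\lambda=(\ell_1+\cdots+\ell_r,\dots,\ell_1+\ell_2,\ell_1)$, $\rho=(r,r-1,\dots,1)$. Let $\Psi:(F_S^\times)^r\to\mathbb{C}$ be a function, let $\mathbf s=(s_1,\dots,s_r)\in\mathbb{C}^r$, and define the ($p$-part of the) multiple Dirichlet series $$\mathcal Z_\Psi(\mathbf s;p^{\boldsymbol\ell})=\sum_{\mathbf k=(k_1,\dots,k_r)}\frac{H^{(n)}(p^{\mathbf k};p^{\boldsymbol\ell})\,\Psi(p^{\mathbf k})}{|p|^{2k_1s_1}\cdots|p|^{2k_rs_r}},$$ the (finite) sum being over $\mathbf k\in\mathbb{Z}_{\ge0}^r$ and $p^{\mathbf k}=(p^{k_1},\dots,p^{k_r})$, $|p|=q$. Let $\mathbf z=(z_1,\dots,z_r)\in(\mathbb{C}^\times)^r$ satisfy $q^{1-2s_1}=z_r^2$ and $q^{1-2s_i}=z_{r-i+1}/z_{r-i+2}$ for every $i>1$. Consider symplectic ice (see context) with parameter $v=q^{-1}$, function $g(a)=q^{-1}g_a(1,p)$, and spectral parameters $z_1,\dots,z_r$. Then $$\mathcal Z_\Psi(\mathbf s;p^{\boldsymbol\ell})=\mathbf z^{\lambda+\rho}\sum_{\mathbf k=(k_1,\dots,k_r)}\Bigl[\Psi(p^{\mathbf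 k})\sum_{\mathfrak s}\mathrm{wt}(\mathfrak s)\Bigr],$$ where $\mathbf z^{\lambda+\rho}=\prod_{i=1}^r z_i^{\lambda_i+r+1-i}$ and the inner sum is over those $\mathfrak s\in\mathfrak S_\lambda$ whose corresponding strict symplectic pattern $P$ satisfies $\mathbf k(P)=\mathbf k$.
   Context: **Number theory.** $F$ is a number field containing the $2n$-th roots of unity; $S$ is a finite set of places containing all archimedean places and all places ramified over $\mathbb{Q}$, large enough that the ring $\mathcal O_S$ of $S$-integers is a PID; $F_S=\prod_{v\in S}F_v$. $p\in\mathcal O_S$ is a prime element, $q=|\mathcal O_S/p\mathcal O_S|$, and $\varphi(p^a)=q^a(1-q^{-1})$. $g_t(1,p)=\sum_{d\in(\mathcal O_S/p)^\times}\left(\frac dp\right)_n^t\psi(d/p)$ is the $n$-th power Gauss sum, with $\left(\frac{\cdot}{p}\right)_n$ the $n$-th power residue symbol (values in $\mathbb{C}^\times$ via a fixed embedding of $\mu_n$) and $\psi$ an additive character of $F_S$ trivial on $\mathcal O_S$ but on no larger fractional ideal. **Patterns.** A symplectic pattern $P$ is an array of nonnegative integers $a_{i,j}$ ($0\le i\le r-1$, $i<j\le r$) and $b_{i,j}$ ($1\le i\le j\le r$) with rows $(a_{0,1},\dots,a_{0,r})$, $(b_{1,1},\dots,b_{1,r})$, $(a_{1,2},\dots,a_{1,r})$, $(b_{2,2},\dots,b_{2,r}),\dots,(a_{r-1,r})$, $(b_{r,r})$ that interleave: $\min\{a_{i-1,j},a_{i,j}\}\ge b_{i,j}\ge\max\{a_{i-1,j+1},a_{i,j+1}\}$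 and $\min\{b_{i+1,j-1},b_{i,j-1}\}\ge a_{i,j}\ge\max\{b_{i+1,j},b_{i,j}\}$, entries not in $P$ being omitted from these inequalities. $P$ is strict if each row is strictly decreasing and all $a_{i,r}\ne0$. $\mathrm{GT}_{\rm str}(\lambda+\rho)$ is the set of strict patterns with top row $\lambda+\rho$. Below, entries not appearing in $P$ are set to $0$. For $1\le i\le j\le r$ put $v_{i,j}=\sum_{k=i}^{j}(a_{i-1,k}-b_{i,k})$, $w_{i,j}=\sum_{k=j}^r(a_{i,k}-b_{i,k})$, $u_{i,j}=v_{i,r}+w_{i,j}$. Let $s_a(i)=\sum_{k=i+1}^r a_{i,k}$, $s_b(i)=\sum_{k=i}^r b_{i,k}$, $\mathrm{wt}_i(P)=s_a(r-i)-2s_b(r-i+1)+s_a(r-i+1)$, write $\lambda+\rho=(L_r,\dots,L_1)$, and set $\mathbf k(P)=(k_1(P),\dots,k_r(P))$ with $k_1(P)=\frac12\sum_{j=1}^r(\mathrm{wt}_j(P)+L_j)$ and $k_i(P)=\sum_{j=i}^r(\mathrm{wt}_j(P)+L_j)$ for $i\ne1$. For entries $a_{i,j}$ with $i\ge1$: $\gamma(a_{i,j})=q^{u_{i,j}-1}g_{u_{i,j}}(1,p)$ if $a_{i,j}=b_{i,j-1}$; $q^{u_{i,j}}$ if $a_{i,j}=b_{i,j}$; and if $b_{i,j}<a_{i,j}<b_{i,j-1}$, $\varphi(p^{u_{i,j}})$ when $n\mid u_{i,j}$ and $0$ when $n\nmid u_{i,j}$. For entries $b_{i,j}$, with $\delta_{jr}$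 the Kronecker delta and $a_{i-1,r+1}=0$: $\gamma(b_{i,j})=q^{v_{i,j}}$ if $b_{i,j}=a_{i-1,j}$; $q^{v_{i,j}-1}g_{(1+\delta_{jr})v_{i,j}}(1,p)$ if $b_{i,j}=a_{i-1,j+1}$; and if $a_{i-1,j+1}<b_{i,j}<a_{i-1,j}$, $\varphi(p^{v_{i,j}})$ when $n\mid(1+\delta_{jr})v_{i,j}$ and $0$ otherwise. Let $G(P)$ be the product of all $\gamma(a_{i,j})$ ($1\le i<j\le r$) and all $\gamma(b_{i,j})$ ($1\le i\le j\le r$), and $$H^{(n)}(p^{\mathbf k};p^{\boldsymbol\ell})=\sum_{P\in \mathrm{GT}_{\rm str}(\lambda+\rho):\ \mathbf k(P)=\mathbf k}G(P).$$ **Symplectic ice.** $\delta(a)=1$ if $n\mid a$, else $0$; $h(a)=(1-v)\delta(a)$. Take a rectangular lattice with $\lambda_1+r$ columns, numbered $1,\dots,\lambda_1+r$ from right to left, and $2r$ rows labelled $1,\overline1,\dots,r,\overline r$ from top to bottom. Each row has $\lambda_1+r+1$ horizontal edges; the rightmost edges of rows $i,\overline i$ are joined by a bend with one bend vertex. Edges carry spins $\pm$; left and bottom boundary spins are $+$; the top boundary spin is $-$ exactly in the columns numbered by the parts of $\lambda+\rho$. A state (assignment of the remaining spins) is admissible if the two edges at each bend have different spins and every other vertex is one of (left, right; top, bottom): $a_1=(+,+;+,+)$, $a_2=(-,-;-,-)$, $b_1=(+,+;-,-)$, $b_2=(-,-;+,+)$, $c_1=(-,+;+,-)$, $c_2=(+,-;-,+)$.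 $\mathfrak S_\lambda$ is the set of admissible states. Charge: in row $i$ the charge at a horizontal edge is the number of $-$ spins on horizontal edges of the row at and to its left, the charge at a vertex is that of its left edge, and the charge at the bend vertex is that of the rightmost edge of row $i$. In row $\overline i$ the charge at a horizontal edge is the charge at the bend vertex plus the number of $+$ spins on horizontal edges of the row at and to its right; the charge at a vertex is that of its right edge. Weights: a vertex of charge $a$ in row $i$ has weight $a_1:1$, $a_2:g(a)z_i$, $b_1:1$, $b_2:z_i$, $c_1:h(a)z_i$, $c_2:\delta(a)$; in row $\overline i$: $a_1:1$, $a_2:z_i^{-1}$, $b_1:g(a)$, $b_2:z_i^{-1}$, $c_1:h(a)z_i^{-1}$, $c_2:\delta(a)$. The bend joining rows $i,\overline i$, of charge $a$, has weight $g(2a)z_i$ if its row-$i$ edge is $-$ (row-$\overline i$ edge $+$), and $z_i^{-1}$ if its row-$i$ edge is $+$ (row-$\overline i$ edge $-$). $\mathrm{wt}(\mathfrak s)$ is the product of all vertex weights including bends. **Correspondence.** The pattern corresponding to $\mathfrak s\in\mathfrak S_\lambda$ has $a_{i-1,i}>\cdots>a_{i-1,r}$ equal to the numbers of the columns with a $-$ spin on the vertical edge just above row $i$, and $b_{i,i}>\cdots>b_{i,r}$ equal to the numbers of the columns with a $-$ spin on the vertical edge just above row $\overline i$, with $b_{i,r}=0$ appended when the row-$i$ edge of the bend is $-$. This is a bijection $\mathfrak S_\lambda\to\mathrm{GT}_{\rm str}(\lambda+\rho)$. *)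

(* Defs.v *)
From HB Require Import structures.
From mathcomp Require Import all_boot all_order all_algebra all_field.
From mathcomp Require Import complex.
From mathcomp Require Import boolp classical_sets functions cardinality fsbigop.
From mathcomp Require Import reals exp trigo.

Set Implicit Arguments.
Unset Strict Implicit.
Unset Printing Implicit Defensive.

Import Order.TTheory GRing.Theory Num.Theory.
Local Open Scope classical_set_scope.
Local Open Scope ring_scope.
Local Open Scope complex_scope.

Record absval (R : realType) (F : fieldType) := AbsVal {
  av :> F -> R;
  av_ge0 : forall x, 0 <= av x;
  av_eq0 : forall x, (av x == 0) = (x == 0);
  avM : forall x y, av (x * y) = av x * av y;
  avD : forall x y, av (x + y) <= av x + av y;
  av_nontrivial : exists2 x, x != 0 & av x != 1 }.

(* A place of [F] is a class of nontrivial absolute values modulo [av_equiv]. *)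
Definition av_equiv (R : realType) (F : fieldType) (nu mu : absval R F) : Prop :=
  exists2 c : R, 0 < c & forall x, nu x = mu x `^ c.

Definition nonarchimedean (R : realType) (F : fieldType) (nu : absval R F) : Prop :=
  forall x y, nu (x + y) <= Num.max (nu x) (nu y).

(* The ramification index of [nu] over Q is the index of the value group of
   Q^* in that of F^*, so [nu] is ramified when these groups differ. *)
Definition ramified (R : realType) (F : fieldExtType rat) (nu : absval R F) : Prop :=
  nonarchimedean nu /\
  exists2 x : F, x != 0 & forall a : rat, a != 0 -> nu (ratr a) != nu x.

Definition in_places (R : realType) (F : fieldType) (m : nat)
    (S : 'I_m -> absval R F) (nu : absval R F) : Prop :=
  exists v, av_equiv nu (S v).

(* [S] lists pairwise distinct places, among which all the archimedean places
   and all the places ramified over Q. *)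
Definition admissible_places (R : realType) (F : fieldExtType rat) (m : nat)
    (S : 'I_m -> absval R F) : Prop :=
  [/\ forall v w, av_equiv (S v) (S w) -> v = w,
      forall nu, ~ nonarchimedean nu -> in_places S nu
    & forall nu, ramified nu -> in_places S nu].

Definition S_integers (R : realType) (F : fieldType) (m : nat)
    (S : 'I_m -> absval R F) : set F :=
  [set x | forall nu, ~ in_places S nu -> nu x <= 1].

Definition pideal (F : fieldType) (O : set F) (a : F) : set F :=
  [set a * y | y in O].

Definition is_ideal (F : fieldType) (O I : set F) : Prop :=
  [/\ I `<=` O, I 0, forall x y, I x -> I y -> I (x + y)
    & forall a x, O a -> I x -> I (a * x)].

Definition is_PID (F : fieldType) (O : set F) : Prop :=
  forall I, is_ideal O I -> exists2 a, O a & I = pideal O a.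

Definition fractional_ideal (F : fieldType) (O J : set F) : Prop :=
  [/\ exists2 x, J x & x != 0,
      forall x y, J x -> J y -> J (x + y),
      forall a x, O a -> J x -> J (a * x)
    & exists d, [/\ O d, d != 0 & forall x, J x -> O (d * x)]].

Record prime_element (F : fieldType) (O : set F) (p : F) : Prop := PrimeElement {
  prime_element_in : O p;
  prime_element_neq0 : p != 0;
  prime_element_nonunit : ~ O p^-1;
  prime_element_mul : forall x y, O x -> O y ->
    pideal O p (x * y) -> pideal O p x \/ pideal O p y }.

Definition coset (F : fieldType) (O : set F) (p x : F) : set F :=
  [set x + y | y in pideal O p].

Definition residue_ring (F : fieldType) (O : set F) (p : F) : set (set F) :=
  [set coset O p x | x in O].

Definition residue_units (F : fieldType) (O : set F) (p : F) : set (set F) :=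
  [set coset O p x | x in [set x | O x /\ exists2 y, O y & pideal O p (x * y - 1)]].

Record completion (R : realType) (F : fieldType) (nu : absval R F) := Completion {
  cpl_field : fieldType;
  cpl_abs : absval R cpl_field;
  cpl_emb : {rmorphism F -> cpl_field};
  cpl_emb_abs : forall x, cpl_abs (cpl_emb x) = nu x;
  cpl_dense : forall (y : cpl_field) (e : R), 0 < e ->
    exists x, cpl_abs (y - cpl_emb x) < e;
  cpl_complete : forall u : nat -> cpl_field,
    (forall e : R, 0 < e -> exists N, forall i j, (N <= i)%N -> (N <= j)%N ->
       cpl_abs (u i - u j) < e) ->
    exists y, forall e : R, 0 < e -> exists N, forall i, (N <= i)%N ->
       cpl_abs (u i - y) < e }.

Section SAdeles.
Context (R : realType) (F : fieldType) (m : nat) (S : 'I_m -> absval R F).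
Context (Fv : forall v, completion (S v)).

(* F_S is the product of the F_v, with the product topology; F_S^* is the
   product of the F_v^*. *)
Definition FS : Type := forall v : 'I_m, cpl_field (Fv v).

Definition FS_units : Type := forall v : 'I_m, {x : cpl_field (Fv v) | x != 0}.

Definition FS_diag (x : F) : FS := fun v => cpl_emb (Fv v) x.

Record additive_character (psi : FS -> R[i]) : Prop := AdditiveCharacter {
  character_add : forall x y : FS, psi (fun v => x v + y v) = psi x * psi y;
  character_norm : forall x, `|psi x| = 1;
  character_continuous : forall (x : FS) (e : R), 0 < e ->
    exists2 d : R, 0 < d & forall y : FS,
      (forall v, cpl_abs (Fv v) (y v - x v) < d) -> `|psi y - psi x| < e%:C }.

Definition conductor_is (O : set F) (psi : FS -> R[i]) : Prop :=
  (forall x, O x -> psi (FS_diag x) = 1) /\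
  forall J, fractional_ideal O J -> O `<=` J ->
    (forall x, J x -> psi (FS_diag x) = 1) -> J `<=` O.

Lemma FS_pow_proof (O : set F) (p : F) (hp : prime_element O p) (k : nat) (v : 'I_m) :
  cpl_emb (Fv v) (p ^+ k) != 0.
Proof. by rewrite fmorph_eq0 expf_neq0 // (prime_element_neq0 hp). Qed.

(* p^k = (p^{k_1}, ..., p^{k_r}) in (F_S^* )^r, F being embedded diagonally *)
Definition FS_pow (O : set F) (p : F) (hp : prime_element O p) (r : nat)
    (k : {ffun 'I_r -> nat}) : 'I_r -> FS_units :=
  fun i v => exist _ (cpl_emb (Fv v) (p ^+ k i)) (FS_pow_proof hp (k i) v).

End SAdeles.

Definition mu_embedding (K F : fieldType) (n : nat) (eps : F -> K) : Prop :=
  [/\ forall x, n.-unity_root x -> eps x != 0,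
      forall x y, n.-unity_root x -> n.-unity_root y -> eps (x * y) = eps x * eps y
    & forall x y, n.-unity_root x -> n.-unity_root y -> eps x = eps y -> x = y].

(* For d prime to p, (d/p)_n is the n-th root of unity congruent to d^((q-1)/n)
   modulo p, transported by [eps]. *)
Definition residue_symbol (K F : fieldType) (O : set F) (p : F) (q n : nat)
    (eps : F -> K) (d : F) : K :=
  if `[< pideal O p d >] then 0
  else eps (xget 0 [set x | n.-unity_root x /\ pideal O p (d ^+ (q.-1 %/ n) - x)]).

(* g_t(1,p); the summand does not depend on the representative chosen in each
   coset when [psi] is trivial on [O]. *)
Definition gauss_sum (R : realType) (F : fieldType) (m : nat)
    (S : 'I_m -> absval R F) (Fv : forall v, completion (S v))
    (O : set F) (p : F) (q n : nat) (eps : F -> R[i]) (psi : FS Fv -> R[i])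
    (t : int) : R[i] :=
  \sum_(D \in residue_units O p)
    (residue_symbol O p q n eps (xget 0 D) ^ t * psi (FS_diag Fv (xget 0 D / p))).

(* x^s for x > 0 *)
Definition cpow (R : realType) (x : R) (s : R[i]) : R[i] :=
  (x `^ complex.Re s)%:C *
  (cos (complex.Im s * ln x) +i* sin (complex.Im s * ln x)).

(* [pa P i j] and [pb P i j] are a_{i,j} and b_{i,j} with their usual indices,
   and vanish at indices outside the array (see [supported]). *)
Record pattern := Pattern { pa : nat -> nat -> nat; pb : nat -> nat -> nat }.
HB.instance Definition _ := gen_eqMixin pattern.
HB.instance Definition _ := gen_choiceMixin pattern.

(* [l i] is ell_{i+1}; [lamrho l j] is the j-th part of lambda + rho, that is
   lambda_j + r + 1 - j with lambda_j = ell_1 + ... + ell_{r+1-j}. *)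
Definition lam (r : nat) (l : 'I_r -> nat) (j : nat) : nat :=
  (\sum_(k < r | k < r.+1 - j) l k)%N.

Definition lamrho (r : nat) (l : 'I_r -> nat) (j : nat) : nat :=
  (lam l j + (r.+1 - j))%N.

Section Patterns.
Context (r : nat).

Definition in_a (i j : nat) : bool := (i < j <= r)%N.
Definition in_b (i j : nat) : bool := (1 <= i <= j)%N && (j <= r)%N.

Local Open Scope nat_scope.

Definition supported (P : pattern) : Prop :=
  (forall i j, ~~ in_a i j -> pa P i j = 0) /\
  (forall i j, ~~ in_b i j -> pb P i j = 0).

Definition interleaving (P : pattern) : Prop :=
  (forall i j, in_b i j ->
    [/\ in_a i.-1 j -> pb P i j <= pa P i.-1 j,
        in_a i j -> pb P i j <= pa P i j,
        in_a i.-1 j.+1 -> pa P i.-1 j.+1 <= pb P i j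
      & in_a i j.+1 -> pa P i j.+1 <= pb P i j]) /\
  (forall i j, in_a i j ->
    [/\ in_b i.+1 j.-1 -> pa P i j <= pb P i.+1 j.-1,
        in_b i j.-1 -> pa P i j <= pb P i j.-1,
        in_b i.+1 j -> pb P i.+1 j <= pa P i j
      & in_b i j -> pb P i j <= pa P i j]).

Definition strict (P : pattern) : Prop :=
  [/\ forall i j, in_a i j -> in_a i j.+1 -> pa P i j.+1 < pa P i j,
      forall i j, in_b i j -> in_b i j.+1 -> pb P i j.+1 < pb P i j
    & forall i, in_a i r -> pa P i r <> 0].

(* the top row is (T 1, ..., T r) *)
Definition GTstr (T : nat -> nat) : set pattern :=
  [set P | [/\ supported P, interleaving P, strict P
             & forall j, 1 <= j <= r -> pa P 0 j = T j]].

Local Close Scope nat_scope.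

Definition pat_v (P : pattern) (i j : nat) : int :=
  \sum_(i <= k < j.+1) ((pa P i.-1 k)%:Z - (pb P i k)%:Z).
Definition pat_w (P : pattern) (i j : nat) : int :=
  \sum_(j <= k < r.+1) ((pa P i k)%:Z - (pb P i k)%:Z).
Definition pat_u (P : pattern) (i j : nat) : int := pat_v P i r + pat_w P i j.

Definition s_a (P : pattern) (i : nat) : int :=
  \sum_(i.+1 <= k < r.+1) (pa P i k)%:Z.
Definition s_b (P : pattern) (i : nat) : int :=
  \sum_(i <= k < r.+1) (pb P i k)%:Z.
Definition pat_wt (P : pattern) (i : nat) : int :=
  s_a P (r - i) - 2 * s_b P (r - i).+1 + s_a P (r - i).+1.

(* k_i(P) for 1 <= i <= r; the top row is (L_r, ..., L_1), so L_j = T (r + 1 - j) *)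
Definition kvec (T : nat -> nat) (P : pattern) (i : nat) : rat :=
  let S := \sum_(i <= j < r.+1) (pat_wt P j + (T (r.+1 - j)%N)%:Z) in
  if i == 1%N then S%:~R / 2 else S%:~R.

Definition has_kvec (T : nat -> nat) (P : pattern) (k : {ffun 'I_r -> nat}) : bool :=
  [forall i : 'I_r, kvec T P i.+1 == (k i)%:R].

Section Coefficients.
Context (K : fieldType) (n : nat) (q : K) (gs : int -> K).

Definition phi_pow (a : int) : K := q ^ a * (1 - q^-1).

Definition gamma_a (P : pattern) (i j : nat) : K :=
  let u := pat_u P i j in
  if pa P i j == pb P i j.-1 then q ^ (u - 1) * gs u
  else if pa P i j == pb P i j then q ^ u
  else if (pb P i j < pa P i j < pb P i j.-1)%N && (n%:Z %| u)%Z then phi_pow u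
  else 0.

Definition gamma_b (P : pattern) (i j : nat) : K :=
  let v := pat_v P i j in
  let dv := (1 + (j == r))%N%:Z * v in
  if pb P i j == pa P i.-1 j then q ^ v
  else if pb P i j == pa P i.-1 j.+1 then q ^ (v - 1) * gs dv
  else if (pa P i.-1 j.+1 < pb P i j < pa P i.-1 j)%N && (n%:Z %| dv)%Z then phi_pow v
  else 0.

Definition pat_G (P : pattern) : K :=
  (\prod_(1 <= i < r.+1) \prod_(i.+1 <= j < r.+1) gamma_a P i j) *
  (\prod_(1 <= i < r.+1) \prod_(i <= j < r.+1) gamma_b P i j).

Definition H_coef (l : 'I_r -> nat) (k : {ffun 'I_r -> nat}) : K :=
  \sum_(P \in [set P | GTstr (lamrho l) P /\ has_kvec (lamrho l) P k]) pat_G P.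

End Coefficients.
End Patterns.

(* A spin is a boolean, [true] standing for the spin -. The row labelled i+1
   (resp. its barred version) is the pair of i : 'I_r and [false]
   (resp. [true]); c : 'I_N is the column numbered c+1 from the right. *)

Inductive vertex_type := A1 | A2 | B1 | B2 | C1 | C2.

Definition vertex_of (left right top bottom : bool) : option vertex_type :=
  match left, right, top, bottom with
  | false, false, false, false => Some A1
  | true, true, true, true => Some A2
  | false, false, true, true => Some B1
  | true, true, false, false => Some B2
  | true, false, false, true => Some C1
  | false, true, true, false => Some C2
  | _, _, _, _ => None
  end.

Section Ice.
Context (r N : nat).

(* Horizontal edges of a row are numbered 0, ..., N from right to left;
   vertical edges lie on levels 0, ..., 2r from top to bottom, level t being
   just above the t-th row (from 0) in the order 1, 1bar, ..., r, rbar. The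
   boundary spins are part of the state and are constrained by [admissible]. *)
Definition ice_state : Type :=
  ({ffun 'I_r * bool * 'I_N.+1 -> bool} * {ffun 'I_(r.*2).+1 * 'I_N -> bool})%type.

Definition hor (s : ice_state) (i : 'I_r) (b : bool) (e : 'I_N.+1) : bool :=
  s.1 (i, b, e).
Definition ver (s : ice_state) (t : nat) (c : 'I_N) : bool := s.2 (inord t, c).

Definition left_edge (c : 'I_N) : 'I_N.+1 := lift ord0 c.
Definition right_edge (c : 'I_N) : 'I_N.+1 := widen_ord (leqnSn N) c.

Definition level (i : 'I_r) (b : bool) : nat := (i.*2 + b)%N.

Definition vertex_at (s : ice_state) (i : 'I_r) (b : bool) (c : 'I_N) :
    option vertex_type :=
  vertex_of (hor s i b (left_edge c)) (hor s i b (right_edge c))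
            (ver s (level i b) c) (ver s (level i b).+1 c).

Definition admissible (T : nat -> nat) (s : ice_state) : bool :=
  [&& [forall i, forall b, ~~ hor s i b ord_max],
      [forall c, ~~ ver s r.*2 c],
      [forall c : 'I_N, ver s 0 c == (c.+1 \in [seq T j | j <- iota 1 r])],
      [forall i, hor s i false ord0 != hor s i true ord0]
    & [forall i, forall b, forall c, vertex_at s i b c]].

Definition bend_charge (s : ice_state) (i : 'I_r) : nat :=
  (\sum_(e < N.+1) hor s i false e)%N.

Definition edge_charge (s : ice_state) (i : 'I_r) (b : bool) (e : 'I_N.+1) : nat :=
  (if b then bend_charge s i + \sum_(e' < N.+1 | e' <= e) ~~ hor s i true e'
   else \sum_(e' < N.+1 | e <= e') hor s i false e')%N.

Definition vertex_charge (s : ice_state) (i : 'I_r) (b : bool) (c : 'I_N) : nat :=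
  edge_charge s i b (if b then right_edge c else left_edge c).

Section Weights.
Context (K : fieldType) (n : nat) (v : K) (g : nat -> K) (z : 'I_r -> K).

Definition ice_delta (a : nat) : K := (n %| a)%:R.
Definition ice_h (a : nat) : K := (1 - v) * ice_delta a.

Definition vertex_weight (s : ice_state) (i : 'I_r) (b : bool) (c : 'I_N) : K :=
  let a := vertex_charge s i b c in
  match vertex_at s i b c, b with
  | Some A1, _ => 1
  | Some A2, false => g a * z i
  | Some B1, false => 1
  | Some B2, false => z i
  | Some C1, false => ice_h a * z i
  | Some A2, true => (z i)^-1
  | Some B1, true => g a
  | Some B2, true => (z i)^-1
  | Some C1, true => ice_h a * (z i)^-1
  | Some C2, _ => ice_delta a
  | None, _ => 0
  end.

Definition bend_weight (s : ice_state) (i : 'I_r) : K :=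
  if hor s i false ord0 then g (2 * bend_charge s i)%N * z i else (z i)^-1.

Definition ice_weight (s : ice_state) : K :=
  (\prod_(i < r) \prod_(b : bool) \prod_(c < N) vertex_weight s i b c) *
  \prod_(i < r) bend_weight s i.

End Weights.

Definition minus_columns (s : ice_state) (t : nat) : seq nat :=
  [seq (val c).+1 | c <- rev (enum 'I_N) & ver s t c].

(* here i is numbered from 1 *)
Definition bend_minus (s : ice_state) (i : nat) : bool :=
  [exists i0 : 'I_r, (i0.+1 == i) && hor s i0 false ord0].

Definition pattern_of (s : ice_state) : pattern :=
  Pattern
    (fun i j => if in_a r i j then nth 0%N (minus_columns s i.*2) (j - i.+1) else 0%N)
    (fun i j => if in_b r i j then
                  nth 0%N (minus_columns s (i.*2).-1 ++ nseq (bend_minus s i) 0%N) (j - i)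
                else 0%N).

End Ice.

(* [qn] is |p|, and [gs t] is g_t(1,p). *)
Definition Z_series (R : realType) (F : fieldType) (m : nat)
    (S : 'I_m -> absval R F) (Fv : forall v, completion (S v))
    (O : set F) (p : F) (hp : prime_element O p) (n qn r : nat) (gs : int -> R[i])
    (Psi : ('I_r -> FS_units Fv) -> R[i]) (l : 'I_r -> nat) (s : 'I_r -> R[i]) : R[i] :=
  \sum_(k \in [set: {ffun 'I_r -> nat}])
    (H_coef n qn%:R gs l k * Psi (FS_pow Fv hp k)
     / \prod_(i < r) cpow (qn%:R : R) (2 * (k i)%:R * s i)).

(* Main.v *)
Require Import Defs.
From HB Require Import structures.
From mathcomp Require Import all_boot all_order all_algebra all_field.
From mathcomp Require Import complex.
From mathcomp Require Import boolp classical_sets functions cardinality fsbigop.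
From mathcomp Require Import reals exp trigo.
From mathcomp Require Import zify ring.

Set Implicit Arguments.
Unset Strict Implicit.
Unset Printing Implicit Defensive.

Import Order.TTheory GRing.Theory Num.Theory.
Local Open Scope classical_set_scope.
Local Open Scope ring_scope.
Local Open Scope complex_scope.

(* A vertex is allowed exactly when left + top = right + bottom, where - counts
   for 1. Hence the spin of a horizontal edge is the difference between the
   numbers of - spins to its left on the vertical edges above and below the
   row, and "this difference is 0 or 1" is the interleaving condition on
   successive rows of a pattern; this gives the bijection with strict patterns.

   The weight of a state factors over the vertices whose lower edge is -, which
   correspond to the entries of the pattern, and the charge at the vertex of
   an entry is v_{i,j} or u_{i,j}. So, up to powers of z_i and of q, the weight is
   G(P): the exponent of z_i is wt_{r+1-i}(P), and q enters with the exponent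
   - sum v_{i,j} - sum u_{i,j} = - (k_1 + ... + k_r). *)

(** * Decreasing sequences *)

(** The factors on the two sides do not match one by one, and two mismatches have to be absorbed. A
    c_2 vertex carries a factor [ice_delta] although no entry of the pattern sits there. Following
    row i from left to right, then the bend, then the barred row from right to left, the charge at a
    c_2 vertex is 0 or the charge at an earlier c_1 vertex, where [ice_h] already tests divisibility
    by n. Conversely, an entry b_{i,r} = 0 has no vertex: its factor is supplied by the bend, and
    the doubled argument in g(2a) is the 1 + delta_{jr} of gamma(b_{i,j}). For b_{i,r} > 0 the
    doubling occurs only in a divisibility test, where it is harmless because n is odd.

    The sum of all v_{i,j} and u_{i,j} depends on the positions of the entries through the first
    moments of the rows. The moments of the b-rows cancel and those of the a-rows telescope to the
    top row, so that only k(P) remains. The resulting power of q is accounted for by the 1 in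
    q^{1-2s_i}. *)

Section DecreasingSequences.
Local Open Scope nat_scope.

(** The terms exceeding [e] form an initial segment, so a decreasing sequence and its counting
    function determine each other, like a partition and its conjugate. The default value 0 exceeds
    no [e], hence no bound on [k]. *)
Lemma nth_gtn_count (s : seq nat) (e k : nat) : sorted geq s ->
  (e < nth 0 s k) = (k < count (ltn e) s).
Proof.
have tr : transitive geq by move=> a b c ? ?; exact: leq_trans (_ : a <= b).
elim: s k => [|a s IH] k //=; first by rewrite nth_nil.
rewrite path_sortedE // => /andP [/allP mins sors].
have cs0 : a <= e -> count (ltn e) s = 0.
  move=> ae; apply/eqP; rewrite -leqn0 leqNgt -has_count -all_predC.
  by apply/allP => x /mins /= xa; rewrite -leqNgt (leq_trans xa).
case: k => [|k] /=; first by case: ltnP => // /cs0 ->.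
rewrite IH //; case: (ltnP e a) => [|/cs0 ->]; by rewrite ?add1n.
Qed.

Lemma sorted_gtn_geq (s : seq nat) : sorted gtn s -> sorted geq s.
Proof. by apply: sub_sorted => x y /ltnW. Qed.

Lemma eq_nth_count (x y : seq nat) (k : nat) : sorted geq x -> sorted geq y ->
  (forall e, count (ltn e) x = count (ltn e) y) -> nth 0 x k = nth 0 y k.
Proof.
move=> sx sy cxy; wlog: x y sx sy cxy / nth 0 x k <= nth 0 y k => [h|].
  by case/orP: (leq_total (nth 0 x k) (nth 0 y k)) => /h ->.
rewrite leq_eqVlt => /orP [/eqP //|].
by rewrite nth_gtn_count // -cxy -nth_gtn_count // ltnn.
Qed.

Lemma leq_nth_count (x y : seq nat) : sorted geq x -> sorted geq y ->
  (forall k, nth 0 y k <= nth 0 x k) <->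
  (forall e, count (ltn e) y <= count (ltn e) x).
Proof.
move=> sx sy; split=> h => [e|k]; rewrite leqNgt; apply/negP.
  rewrite -nth_gtn_count // => /leq_trans/(_ (h _)).
  by rewrite nth_gtn_count // ltnn.
rewrite nth_gtn_count // => /leq_trans/(_ (h _)).
by rewrite -nth_gtn_count // ltnn.
Qed.

(** With [leq_nth_count]: two rows interleave exactly when their counting functions differ by 0 or 1
    everywhere, which is what a horizontal spin can record. *)
Lemma leq_nthS_count (x y : seq nat) : sorted geq x -> sorted geq y ->
  (forall k, nth 0 x k.+1 <= nth 0 y k) <->
  (forall e, count (ltn e) x <= (count (ltn e) y).+1).
Proof.
move=> sx sy; split=> h => [e|k]; rewrite leqNgt; apply/negP.
  rewrite -nth_gtn_count // => /leq_trans/(_ (h _)).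
  by rewrite nth_gtn_count // ltnn.
rewrite nth_gtn_count // => /leq_trans/(_ (h _)).
by rewrite ltnS -nth_gtn_count // ltnn.
Qed.

Lemma sum_gtn_interval (e M x : nat) : x <= M ->
  \sum_(e <= i < M) (i < x) = x - e.
Proof.
move=> xM; case: (leqP x e) => [xe|ex].
  rewrite big_nat big1 => [|i /andP [ei _]]; first by lia.
  by rewrite ltnNge (leq_trans xe).
rewrite (@big_cat_nat _ _ _ x) //=; last exact: ltnW.
rewrite (@eq_big_nat _ _ _ e x _ (fun=> 1)) => [|i /andP [_ ->] //].
rewrite sum_nat_const_nat muln1 big_nat big1 ?addn0 // => i /andP [xi _].
by rewrite ltnNge xi.
Qed.

End DecreasingSequences.

(** * Edges of an ice state *)

Section IceStates.
Context (r N : nat).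
Implicit Types (s : ice_state r N) (i : 'I_r) (b : bool).
Local Open Scope nat_scope.

Lemma vertex_of_flux (l h t d : bool) : vertex_of l h t d = (l + t == h + d) :> bool.
Proof. by case: l h t d => [] [] [] []. Qed.

Lemma level_lt i b : level i b < r.*2.
Proof. by have := ltn_ord i; rewrite /level; case: b => /=; lia. Qed.

(** Indexing by [nat] allows sums over intervals and shifts of the index; only [e <= N] is
    meaningful. The column numbered x lies between the edges x (left) and x - 1 (right). *)
Definition row_edge s i b (e : nat) : bool := hor s i b (inord e).

Lemma hor_left_edge s i b (c : 'I_N) :
  hor s i b (left_edge c) = row_edge s i b c.+1.
Proof. by congr hor; apply: val_inj; rewrite /= inordK // ltnS. Qed.

Lemma hor_right_edge s i b (c : 'I_N) :
  hor s i b (right_edge c) = row_edge s i b c.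
Proof. by congr hor; apply: val_inj; rewrite /= inordK // ltnS ltnW. Qed.

Lemma hor_ord0 s i b : hor s i b ord0 = row_edge s i b 0.
Proof. by congr hor; apply: val_inj; rewrite /= inordK. Qed.

Lemma hor_ord_max s i b : hor s i b ord_max = row_edge s i b N.
Proof. by congr hor; apply: val_inj; rewrite /= inordK. Qed.

Lemma mem_minus_columns s t (c : 'I_N) : (c.+1 \in minus_columns s t) = ver s t c.
Proof.
rewrite mem_map => [|x y [] /val_inj //].
by rewrite mem_filter mem_rev mem_enum andbT.
Qed.

Lemma minus_columns_bounds s t x : x \in minus_columns s t -> 0 < x <= N.
Proof. by case/mapP => c _ ->; rewrite /= ltn_ord. Qed.

Lemma sorted_minus_columns s t : sorted gtn (minus_columns s t).
Proof.
rewrite /minus_columns filter_rev map_rev rev_sorted sorted_map.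
apply: sorted_filter => [a b c /= ab bc|]; first exact: ltn_trans bc.
rewrite -(@sorted_map _ _ (val : 'I_N -> nat) ltn) val_enum_ord.
exact: iota_ltn_sorted.
Qed.

Definition columns_beyond s t e : nat := count (ltn e) (minus_columns s t).

Lemma columns_beyondS s t (c : 'I_N) :
  columns_beyond s t c = ver s t c + columns_beyond s t c.+1.
Proof.
have u : uniq (minus_columns s t).
  by apply: sorted_uniq (sorted_minus_columns s t) => [x y z /= yx zy|x];
    [exact: ltn_trans zy yx | rewrite /= ltnn].
rewrite -mem_minus_columns -(count_uniq_mem _ u) /columns_beyond.
elim: (minus_columns s t) => //= x m ->; rewrite addnACA; congr (_ + _).
by rewrite /=; lia.
Qed.

Lemma columns_beyond_bound s t e : N <= e -> columns_beyond s t e = 0.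
Proof.
move=> Ne; apply/eqP; rewrite -leqn0 leqNgt -has_count -all_predC.
apply/allP => x /minus_columns_bounds /andP [_ xN] /=.
by rewrite -leqNgt (leq_trans xN).
Qed.

Lemma size_minus_columns s t : size (minus_columns s t) = columns_beyond s t 0.
Proof.
apply/esym/eqP; rewrite -all_count; apply/allP => x.
by case/minus_columns_bounds/andP.
Qed.

Section Admissible.
Context (T : nat -> nat) (s : ice_state r N).
Context (adm : admissible T s).

Lemma admissible_vertex i b (c : 'I_N) :
  row_edge s i b c.+1 + ver s (level i b) c =
  row_edge s i b c + ver s (level i b).+1 c.
Proof.
case/and5P: adm => _ _ _ _ /forallP /(_ i) /forallP /(_ b) /forallP /(_ c).
by rewrite /vertex_at vertex_of_flux hor_left_edge hor_right_edge => /eqP.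
Qed.

Lemma admissible_left i b : row_edge s i b N = false.
Proof.
case/and5P: adm => /forallP /(_ i) /forallP /(_ b) + _ _ _ _.
by rewrite hor_ord_max => /negbTE.
Qed.

Lemma admissible_bend i : row_edge s i true 0 = ~~ row_edge s i false 0.
Proof.
case/and5P: adm => _ _ _ /forallP /(_ i) + _.
by rewrite !hor_ord0; case: row_edge; case: row_edge.
Qed.

Lemma row_flux i b e : e <= N ->
  row_edge s i b e + columns_beyond s (level i b).+1 e =
  columns_beyond s (level i b) e.
Proof.
(* The induction starts at the left boundary, edge [N], whose spin is +, and moves to the right. *)
move=> eN; rewrite -(subKn eN); elim: (N - e) (leq_subr e N) => [_|d IH dN].
  by rewrite subn0 !columns_beyond_bound // admissible_left.
have lt : N - d.+1 < N by lia.
have := admissible_vertex i b (Ordinal lt).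
have := columns_beyondS s (level i b) (Ordinal lt).
have := columns_beyondS s (level i b).+1 (Ordinal lt).
have /= := IH (ltnW dN); have -> : N - d = (N - d.+1).+1 by lia.
lia.
Qed.

Lemma columns_beyond_last e : columns_beyond s r.*2 e = 0.
Proof.
case/and5P: adm => _ /forallP h _ _ _.
apply/eqP; rewrite -leqn0 leqNgt -has_count; apply/hasPn => x xm.
have /andP [x0 xN] := minus_columns_bounds xm.
case: x x0 xN xm => // x _ xN; rewrite (mem_minus_columns s _ (Ordinal xN)).
by rewrite (negbTE (h _)).
Qed.

(** Exactly one of the two edges at a bend is -, so each pair of rows lets exactly one - spin out of
    the vertical edges; none is left at the bottom. *)
Lemma columns_beyond_even (i : nat) : i <= r -> columns_beyond s i.*2 0 = r - i.
Proof.
move=> ir; rewrite -(subKn ir); elim: (r - i) (leq_subr i r) => [_|d IH dr].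
  by rewrite subn0 columns_beyond_last subnn.
have lt : r - d.+1 < r by lia.
have e : r - d = (r - d.+1).+1 by lia.
have := row_flux (Ordinal lt) false (leq0n N).
have := row_flux (Ordinal lt) true (leq0n N).
rewrite admissible_bend /level /= addn0 addn1.
have := IH (ltnW dr); rewrite e doubleS.
by case: row_edge; lia.
Qed.

Lemma columns_beyond_size t : t <= r.*2 -> columns_beyond s t 0 <= r - t./2.
Proof.
rewrite -{1 2}(odd_double_half t); case: (odd t) => /=; last first.
  by rewrite add0n leq_double => /columns_beyond_even ->.
rewrite add1n ltn_double => lt; have := row_flux (Ordinal lt) false (leq0n N).
by rewrite /level /= addn0 columns_beyond_even; lia.
Qed.

End Admissible.
End IceStates.

(** * The bijection with strict patterns *)

Section Rows.
Local Open Scope nat_scope.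

(* Row t of P, counted from the top, is read from its first entry. *)
Definition entry (P : pattern) (t k : nat) : nat :=
  if odd t then pb P t./2.+1 (t./2.+1 + k) else pa P t./2 (t./2.+1 + k).

Lemma entry_even P i k : entry P i.*2 k = pa P i (i.+1 + k).
Proof. by rewrite /entry odd_double doubleK. Qed.

Lemma entry_odd P i k : entry P i.*2.+1 k = pb P i.+1 (i.+1 + k).
Proof. by rewrite /entry /= odd_double uphalf_double. Qed.

(** With left-aligned rows padded by zeros, all interleaving conditions take the single form x_{k+1}
    <= y_k <= x_k. Strictness is asked only at positive entries because the padding repeats 0, and
    positivity only on the a-rows because b_{i,r} may be 0. *)
Record ladder (r : nat) (T : nat -> nat) (P : pattern) : Prop := Ladder {
  ladder_supported : supported r P;
  ladder_le : forall t k, t < r.*2 -> entry P t.+1 k <= entry P t k;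
  ladder_ge : forall t k, t < r.*2 -> entry P t k.+1 <= entry P t.+1 k;
  ladder_lt : forall t k, t < r.*2 -> 0 < entry P t k -> entry P t k.+1 < entry P t k;
  ladder_gt0 : forall i k, i + k < r -> 0 < entry P i.*2 k;
  ladder_top : forall k, k < r -> entry P 0 k = T k.+1 }.

Lemma supported_entry0 r P t k : supported r P -> r <= t./2 + k -> entry P t k = 0.
Proof.
move=> [sa sb] h; rewrite /entry; case: ifP => _; [apply: sb|apply: sa];
rewrite /in_a /in_b; lia.
Qed.

(** The entry b_{i,r} = 0 appended by [pattern_of] coincides with the default value, so the bend can
    be ignored when reading off a row. *)
Lemma nth_cat_nseq0 (x : seq nat) m k : nth 0 (x ++ nseq m 0) k = nth 0 x k.
Proof. by rewrite nth_cat nth_nseq if_same; case: ltnP => // /(nth_default 0). Qed.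

Lemma parityP t : {i | t = i.*2} + {i | t = i.*2.+1}.
Proof.
rewrite -(odd_double_half t); case: (odd t); [right|left]; exists t./2; lia.
Qed.

Lemma GTstr_ladder r T P : GTstr r T P -> ladder r T P.
Proof.
case=> [[sa sb] [ib ia] [sta stb nz] top].
have gt0 i k : i + k < r -> 0 < pa P i (i.+1 + k).
  (* [d] is the distance to a_{i,r}, which is nonzero; strict decrease propagates positivity to the
     left. *)
  move=> h; have [d ed] : exists d, i.+1 + k + d = r by exists (r - (i.+1 + k)); lia.
  elim: d k ed {h} => [|d IH] k ed.
    rewrite lt0n -[i.+1 + k]addn0 ed; apply/eqP/nz; rewrite /in_a; lia.
  have := sta i (i.+1 + k); rewrite /in_a -addnS => /(_ _ _).
  by move=> lt; apply: leq_ltn_trans (lt _ _); lia.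
have ge i k : i < r -> pa P i (i.+1 + k.+1) <= pb P i.+1 (i.+1 + k).
  move=> ir; rewrite addnS; case h: (in_a r i (i.+1 + k).+1); last by rewrite sa ?h.
  have [|_ _ /(_ h) //] := ib i.+1 (i.+1 + k).
  by move: h; rewrite /in_a /in_b; lia.
split=> //.
- move=> t k; case: (parityP t) => -[i ->] ti.
    rewrite entry_odd entry_even; case h: (in_b r i.+1 (i.+1 + k)); last by rewrite sb ?h.
    have [+ _ _ _] := ib _ _ h; apply; move: h; rewrite /in_a /in_b; lia.
  rewrite -doubleS entry_odd entry_even.
  case h: (in_a r i.+1 (i.+2 + k)); last by rewrite sa ?h.
  have [_ + _ _] := ia _ _ h; rewrite addSn /=; apply; move: h; rewrite /in_a /in_b; lia.
- move=> t k; case: (parityP t) => -[i ->] ti.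
    by rewrite entry_odd entry_even; apply: ge; lia.
  rewrite -doubleS entry_odd entry_even addnS -addSn.
  case h: (in_b r i.+1 (i.+2 + k)); last by rewrite sb ?h.
  have [_ + _ _] := ib _ _ h; apply; move: h; rewrite /in_a /in_b; lia.
- move=> t k; case: (parityP t) => -[i ->] ti; rewrite ?entry_odd ?entry_even addnS => pos.
    case h: (in_a r i (i.+1 + k).+1); last by rewrite sa ?h.
    by apply: sta => //; move: h; rewrite /in_a; lia.
  case h: (in_b r i.+1 (i.+1 + k).+1); last by rewrite sb ?h.
  by apply: stb => //; move: h; rewrite /in_b; lia.
- by move=> i k ik; rewrite entry_even gt0.
- by move=> k kr; rewrite -[0]/(0.*2) entry_even add1n top.
Qed.

Lemma ladder_GTstr r T P : ladder r T P -> GTstr r T P.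
Proof.
case=> [[sa sb] le ge lt gt0 top].
have a_entry i j : i < j -> pa P i j = entry P i.*2 (j - i.+1).
  by move=> ij; rewrite entry_even subnKC.
have b_entry i j : 0 < i <= j -> pb P i j = entry P i.-1.*2.+1 (j - i).
  by case/andP => i0 ij; rewrite entry_odd prednK // subnKC.
split=> //.
- split=> i j; rewrite /in_a /in_b => ij; split=> h.
  + rewrite a_entry ?b_entry; [|lia..].
    have -> : i.-1.+1 = i by lia. by apply: le; lia.
  + rewrite a_entry ?b_entry; [|lia..].
    have -> : i.*2 = i.-1.*2.+2 by lia.
    have -> : j - i = (j - i.+1).+1 by lia. by apply: ge; lia.
  + rewrite a_entry ?b_entry; [|lia..].
    have -> : j.+1 - i.-1.+1 = (j - i).+1 by lia. by apply: ge; lia.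
  + rewrite a_entry ?b_entry; [|lia..].
    have -> : i.*2 = i.-1.*2.+2 by lia.
    have -> : j.+1 - i.+1 = j - i by lia. by apply: le; lia.
  + rewrite a_entry ?b_entry /=; [|lia..].
    have -> : j.-1 - i.+1 = (j - i.+1).-1 by lia.
    have -> : j - i.+1 = (j - i.+1).-1.+1 by lia. by apply: ge; lia.
  + rewrite a_entry ?b_entry; [|lia..].
    have -> : i.*2 = i.-1.*2.+2 by lia.
    have -> : j.-1 - i = j - i.+1 by lia. by apply: le; lia.
  + rewrite a_entry ?b_entry; [|lia..]. by apply: le; lia.
  + rewrite a_entry ?b_entry; [|lia..].
    have -> : i.*2 = i.-1.*2.+2 by lia.
    have -> : j - i = (j - i.+1).+1 by lia. by apply: ge; lia.
- split.
  + move=> i j; rewrite /in_a => h1 h2; rewrite !a_entry; [|lia..].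
    have -> : j.+1 - i.+1 = (j - i.+1).+1 by lia.
    apply: lt; first by lia. by apply: gt0; lia.
  + move=> i j; rewrite /in_b => h1 h2; rewrite !b_entry; [|lia..].
    have -> : j.+1 - i = (j - i).+1 by lia.
    apply: lt; first by lia.
    apply: leq_ltn_trans (leq0n _) (leq_trans _ (ge _ _ _)); last by lia.
    by apply: gt0; lia.
  + move=> i h; rewrite a_entry; last by case/andP: h.
    by have := @gt0 i (r - i.+1); move: h; rewrite /in_a; lia.
- move=> j h; rewrite a_entry ?top; [|lia..]. by congr T; lia.
Qed.
End Rows.

Section Correspondence.
Context (r N : nat) (T : nat -> nat).
Implicit Types s : ice_state r N.
Local Open Scope nat_scope.

Lemma entry_pattern_of s t k : admissible T s -> t <= r.*2 ->
  entry (pattern_of s) t k = nth 0 (minus_columns s t) k.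
Proof.
move=> adm tr; have := columns_beyond_size adm tr; rewrite -size_minus_columns.
case: (parityP t) tr => -[i ->] tr; rewrite ?entry_even ?entry_odd /=.
  rewrite doubleK addKn /in_a => sz; case: ifP => // h.
  by rewrite nth_default //; lia.
rewrite uphalf_double nth_cat_nseq0 addKn /in_b => sz; case: ifP => // h.
by rewrite nth_default //; lia.
Qed.

Lemma supported_pattern_of s : supported r (pattern_of s).
Proof. by split=> i j h; rewrite /= (negbTE h). Qed.

Lemma sorted_minus_columns_geq s t : sorted geq (minus_columns s t).
Proof. exact/sorted_gtn_geq/sorted_minus_columns. Qed.

Lemma columns_beyond_step s t e : admissible T s -> t < r.*2 ->
  columns_beyond s t.+1 e <= columns_beyond s t e <= (columns_beyond s t.+1 e).+1.
Proof.
move=> adm tr; case: (leqP N e) => eN; first by rewrite !columns_beyond_bound.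
have ir : t./2 < r by lia.
have := row_flux adm (Ordinal ir) (odd t) (ltnW eN).
have -> : level (Ordinal ir) (odd t) = t by rewrite /level /= addnC odd_double_half.
by case: row_edge; lia.
Qed.

Lemma top_minus_columns s : admissible T s ->
  (forall j, 1 <= j <= r -> T j <= N) ->
  (forall j, 1 <= j < r -> T j.+1 < T j) -> (0 < r -> 0 < T r) ->
  minus_columns s 0 = [seq T j | j <- iota 1 r].
Proof.
move=> adm TN Tlt Tpos.
have sT : sorted gtn [seq T j | j <- iota 1 r].
  apply/(sortedP 0) => i; rewrite size_map size_iota => ir.
  by rewrite !(nth_map 0) ?size_iota ?(ltnW ir) // !nth_iota ?(ltnW ir) //= Tlt.
have Tgt0 j : 1 <= j <= r -> 0 < T j.
  case/andP => j0 jr; have [->|jr'] := eqVneq j r; first by apply: Tpos; lia.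
  by apply: leq_ltn_trans (leq0n (T j.+1)) (Tlt _ _); lia.
have gtn_trans : transitive gtn by move=> a b c /= ab bc; exact: ltn_trans bc ab.
apply: (irr_sorted_eq gtn_trans _ (sorted_minus_columns s 0) sT) => [x|x].
  by rewrite /= ltnn.
have inT y : y \in [seq T j | j <- iota 1 r] -> 0 < y <= N.
  by case/mapP => j; rewrite mem_iota => jr ->; rewrite TN ?Tgt0; lia.
apply/idP/idP => xin.
  case: x xin (minus_columns_bounds xin) => // x xin /andP [_ xN].
  case/and5P: adm => _ _ /forallP /(_ (Ordinal xN)) /eqP + _ _.
  by rewrite -mem_minus_columns xin => <-.
case: x xin (inT _ xin) => // x xin /andP [_ xN].
case/and5P: adm => _ _ /forallP /(_ (Ordinal xN)) /eqP + _ _.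
by rewrite xin -mem_minus_columns.
Qed.

Lemma pattern_of_ladder s : admissible T s ->
  (forall j, 1 <= j <= r -> T j <= N) ->
  (forall j, 1 <= j < r -> T j.+1 < T j) -> (0 < r -> 0 < T r) ->
  ladder r T (pattern_of s).
Proof.
move=> adm TN Tlt Tpos; split.
- exact: supported_pattern_of.
- move=> t k tr; rewrite !entry_pattern_of //; last exact: ltnW.
  apply: (leq_nth_count _ _).2 => [||e]; try exact: sorted_minus_columns_geq.
  by case/andP: (columns_beyond_step e adm tr).
- move=> t k tr; rewrite !entry_pattern_of //; last exact: ltnW.
  apply: (leq_nthS_count _ _).2 => [||e]; try exact: sorted_minus_columns_geq.
  by case/andP: (columns_beyond_step e adm tr).
- move=> t k tr; rewrite !entry_pattern_of ?(ltnW tr) // => pos.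
  case: (ltnP k.+1 (size (minus_columns s t))) => h; last by rewrite nth_default.
  by have /sortedP -/(_ 0 k h) := sorted_minus_columns s t.
- move=> i k ik; rewrite entry_pattern_of //; last by lia.
  have /mem_nth -/(_ 0) : k < size (minus_columns s i.*2).
    by rewrite size_minus_columns (columns_beyond_even adm); lia.
  by case/minus_columns_bounds/andP.
- move=> k kr; rewrite entry_pattern_of // top_minus_columns //.
  by rewrite (nth_map 0) ?size_iota // nth_iota // add1n.
Qed.

(** The entries determine the counting functions; their increments are the vertical spins, and
    [row_flux] then gives every horizontal spin. *)
Lemma pattern_of_inj s1 s2 : admissible T s1 -> admissible T s2 ->
  pattern_of s1 = pattern_of s2 -> s1 = s2.
Proof.
move=> adm1 adm2 eqP12.
have eqc t e : t <= r.*2 -> columns_beyond s1 t e = columns_beyond s2 t e.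
  move=> tr; apply/eqP; rewrite eqn_leq; apply/andP; split;
  apply: (leq_nth_count _ _).1 => [||k]; try exact: sorted_minus_columns_geq;
  by rewrite -!entry_pattern_of // eqP12.
have eqv t (c : 'I_N) : t <= r.*2 -> ver s1 t c = ver s2 t c.
  move=> tr; have := columns_beyondS s1 t c; rewrite !eqc // columns_beyondS.
  by case: ver; case: ver; lia.
have eqh i b (e : 'I_N.+1) : hor s1 i b e = hor s2 i b e.
  have eN : e <= N by rewrite -ltnS.
  have := row_flux adm1 i b eN; have := row_flux adm2 i b eN.
  have lr := level_lt i b.
  rewrite !eqc ?(ltnW lr) // /row_edge inord_val.
  by case: hor; case: hor; lia.
case: s1 s2 eqv eqh {adm1 adm2 eqP12 eqc} => [h1 v1] [h2 v2] eqv eqh; congr pair.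
  by apply/ffunP => -[[i b] e]; have := eqh i b e.
apply/ffunP => -[t c]; have := eqv t c; rewrite /ver /= inord_val; apply.
by rewrite -ltnS.
Qed.

Definition row_seq (P : pattern) (t : nat) : seq nat := mkseq (entry P t) r.

(** These are the spins forced by [row_flux]: the two counts differ by 0 or 1, so [!=] is their
    difference. Columns are numbered from 1, hence the padding zeros of [row_seq] mark no column. *)
Definition ice_of (P : pattern) : ice_state r N :=
  ([ffun x : 'I_r * bool * 'I_N.+1 =>
      count (ltn x.2) (row_seq P (level x.1.1 x.1.2)) !=
      count (ltn x.2) (row_seq P (level x.1.1 x.1.2).+1)],
   [ffun x : 'I_(r.*2).+1 * 'I_N => x.2.+1 \in row_seq P x.1]).

Section IceOf.
Context (P : pattern) (lad : ladder r T P).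

Lemma entry_last k : entry P r.*2 k = 0.
Proof. by apply: supported_entry0 (ladder_supported lad) _; lia. Qed.

Lemma nth_row_seq t k : nth 0 (row_seq P t) k = entry P t k.
Proof.
case: (ltnP k r) => kr; first by rewrite nth_mkseq.
rewrite nth_default ?size_mkseq // (supported_entry0 (ladder_supported lad)) //.
exact: leq_trans kr (leq_addl _ _).
Qed.

Lemma entry_nonincreasing t k : t <= r.*2 -> entry P t k.+1 <= entry P t k.
Proof.
rewrite leq_eqVlt => /orP [/eqP -> | tr]; first by rewrite !entry_last.
exact: leq_trans (ladder_ge lad k tr) (ladder_le lad k tr).
Qed.

Lemma sorted_row_seq t : t <= r.*2 -> sorted geq (row_seq P t).
Proof.
by move=> tr; apply/(sortedP 0) => k _; rewrite !nth_row_seq /= entry_nonincreasing.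
Qed.

Context (TN : 0 < r -> T 1 <= N).

Lemma entry_bound t k : t <= r.*2 -> entry P t k <= N.
Proof.
elim: t k => [|t IH] k tr; last first.
  exact: leq_trans (ladder_le lad k tr) (IH k (ltnW tr)).
elim: k => [|k IHk]; last exact: leq_trans (entry_nonincreasing k tr) IHk.
case: (posnP r) => r0; last by rewrite (ladder_top lad) ?TN.
by rewrite (supported_entry0 (ladder_supported lad)) ?r0.
Qed.

Lemma minus_columns_ice_of t : t <= r.*2 ->
  minus_columns (ice_of P) t = [seq x <- row_seq P t | 0 < x].
Proof.
move=> tr; have gtn_trans : transitive gtn by move=> a b c /= ab bc; exact: ltn_trans bc ab.
apply: (irr_sorted_eq gtn_trans) => [x||| x]; first by rewrite /= ltnn.
- exact: sorted_minus_columns.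
(* A padded row is not strictly decreasing; [R] tolerates repeated zeros and implies [gtn] on the
   positive entries kept by the filter. *)
- pose R := [rel x y | (y < x) || (x == 0) && (y == 0)].
  have Rtr : transitive R by move=> a b c /=; lia.
  apply: (@sub_in_sorted _ [pred x | 0 < x] R) => [x y /=||].
  + by rewrite !inE; lia.
  + exact: filter_all.
  apply: sorted_filter => //; apply/(sortedP 0) => k _; rewrite !nth_row_seq /=.
  have := entry_nonincreasing k tr; case: (ltnP t r.*2) => [tr2|rt].
    by have := @ladder_lt _ _ _ lad _ k tr2; lia.
  have -> : t = r.*2 by lia.
  rewrite !entry_last.
  by [].
rewrite mem_filter; apply/idP/andP => [xm|[x0 xr]].
  have /andP [x0 xN] := minus_columns_bounds xm; split=> //.
  case: x x0 xN xm => // x _ xN; rewrite (mem_minus_columns _ _ (Ordinal xN)).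
  by rewrite /ver ffunE /= inordK // ltnS.
have xN : x <= N by case/mapP: xr => k _ ->; exact: entry_bound.
case: x x0 xN xr => // x _ xN; rewrite (mem_minus_columns _ _ (Ordinal xN)).
by rewrite /ver ffunE /= inordK // ltnS.
Qed.

Lemma columns_beyond_ice_of t e : t <= r.*2 ->
  columns_beyond (ice_of P) t e = count (ltn e) (row_seq P t).
Proof.
move=> tr; rewrite /columns_beyond minus_columns_ice_of // count_filter.
by apply: eq_count => x /=; case: ltnP => // /(leq_trans (ltn0Sn e)) ->.
Qed.

Lemma pattern_of_ice_of : pattern_of (ice_of P) = P.
Proof.
have nthE t k : t <= r.*2 -> nth 0 (minus_columns (ice_of P) t) k = entry P t k.
  move=> tr; rewrite -nth_row_seq; apply: eq_nth_count => [||e].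
  - exact: sorted_minus_columns_geq.
  - exact: sorted_row_seq.
  - by rewrite -columns_beyond_ice_of.
have [sa sb] := ladder_supported lad.
case: P lad sa sb nthE => a b /= _ sa sb nthE; congr Pattern;
  apply/funext => i; apply/funext => j.
  case: ifPn => [ij|/sa -> //]; rewrite nthE ?entry_even ?subnKC //;
  by move: ij; rewrite /in_a; lia.
case: ifPn => [ij|/sb -> //]; rewrite nth_cat_nseq0.
have -> : i.*2.-1 = i.-1.*2.+1 by move: ij; rewrite /in_b; lia.
have i0 : 0 < i by move: ij; rewrite /in_b; lia.
have ji : i <= j <= r by move: ij; rewrite /in_b; lia.
rewrite nthE; last by lia.
by rewrite entry_odd prednK // subnKC; last by case/andP: ji.
Qed.

Lemma ice_of_flux i b (e : nat) : e <= N ->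
  row_edge (ice_of P) i b e + columns_beyond (ice_of P) (level i b).+1 e =
  columns_beyond (ice_of P) (level i b) e.
Proof.
move=> eN; have lr := level_lt i b.
rewrite !columns_beyond_ice_of ?(ltnW lr) // /row_edge /hor ffunE /= inordK ?ltnS //.
have : count (ltn e) (row_seq P (level i b).+1) <= count (ltn e) (row_seq P (level i b)).
  apply: (leq_nth_count _ _).1 => [||k]; rewrite ?sorted_row_seq ?(ltnW lr) //.
  by rewrite !nth_row_seq (ladder_le lad).
have : count (ltn e) (row_seq P (level i b)) <= (count (ltn e) (row_seq P (level i b).+1)).+1.
  apply: (leq_nthS_count _ _).1 => [||k]; rewrite ?sorted_row_seq ?(ltnW lr) //.
  by rewrite !nth_row_seq (ladder_ge lad).
by case: eqP; lia.
Qed.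

Lemma ice_of_admissible : admissible T (ice_of P).
Proof.
(* An a-row has exactly [r - i] positive entries; the drop by one from a pair of rows to the next is
   the bend condition. *)
have cE (i : nat) : i <= r -> columns_beyond (ice_of P) i.*2 0 = r - i.
  move=> ir; have ir2 : i.*2 <= r.*2 by rewrite leq_double.
  rewrite columns_beyond_ice_of //; apply/eqP; rewrite eqn_leq; apply/andP; split.
    rewrite leqNgt -nth_gtn_count ?sorted_row_seq // nth_row_seq.
    by rewrite (supported_entry0 (ladder_supported lad)) // doubleK subnKC.
  case e : (r - i) => [|k] //; rewrite -nth_gtn_count ?sorted_row_seq //.
  by rewrite nth_row_seq (ladder_gt0 lad) //; lia.
apply/and5P; split.
- apply/forallP => i; apply/forallP => b; rewrite hor_ord_max.
  have := ice_of_flux i b (leqnn N); rewrite !columns_beyond_bound //.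
  by case: row_edge.
- apply/forallP => c; rewrite /ver ffunE /= inordK //.
  by apply/negP => /mapP [k _]; rewrite entry_last.
- apply/forallP => c; rewrite /ver ffunE /= inordK //; apply/eqP.
  congr (_ \in _); rewrite /row_seq /mkseq -[1]/(1 + 0) iotaDl -map_comp.
  apply/eq_in_map => k; rewrite mem_iota => /= kr.
  by rewrite (ladder_top lad) // add1n.
- apply/forallP => i; rewrite !hor_ord0.
  have := ice_of_flux i false (leq0n N); have := ice_of_flux i true (leq0n N).
  rewrite /level /= addn0 addn1 -doubleS !cE //; last exact: ltnW.
  by have := ltn_ord i; case: row_edge; case: row_edge; lia.
- apply/forallP => i; apply/forallP => b; apply/forallP => c.
  rewrite /vertex_at vertex_of_flux hor_left_edge hor_right_edge.
  have := ice_of_flux i b (ltn_ord c); have := ice_of_flux i b (ltnW (ltn_ord c)).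
  by rewrite (columns_beyondS _ _ c) (columns_beyondS _ (level i b) c); lia.
Qed.

End IceOf.

(** The predicate [C] serves to restrict the bijection to the patterns with a prescribed vector
    k(P). *)
Lemma pattern_of_bij (C : pred pattern) : (0 < r -> T 1 = N) ->
  (forall j, 1 <= j < r -> T j.+1 < T j) -> (0 < r -> 0 < T r) ->
  set_bij [set s | admissible T s && C (pattern_of s)]
          [set P | GTstr r T P /\ C P] (@pattern_of r N).
Proof.
move=> T1 Tlt Tpos.
have TN j : 1 <= j <= r -> T j <= N.
  elim: j => // j IH /andP [_ jr]; have [->|j0] := posnP j.
    by rewrite T1 //; lia.
  by apply: leq_trans (ltnW (Tlt _ _)) (IH _); lia.
split.
- by move=> s /= /andP [adm ->]; split=> //; exact/ladder_GTstr/pattern_of_ladder.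
- by move=> s1 s2 /set_mem /andP [a1 _] /set_mem /andP [a2 _]; exact: pattern_of_inj.
move=> P /= [/GTstr_ladder lad CP].
have T1N : 0 < r -> T 1 <= N by move=> /T1 ->.
by exists (ice_of P); rewrite /= ?pattern_of_ice_of ?ice_of_admissible.
Qed.

End Correspondence.

(** * Counting edges between entries *)

Section Charges.
Context (r N : nat) (T : nat -> nat) (s : ice_state r N).
Context (adm : admissible T s) (lad : ladder r T (pattern_of s)).
Implicit Types (i : 'I_r) (b : bool).
Local Open Scope nat_scope.
Notation P := (pattern_of s).

Lemma ltn_columns_beyond t e k : t <= r.*2 ->
  (k < columns_beyond s t e) = (e < entry P t k).
Proof.
move=> tr; rewrite (entry_pattern_of _ adm) // -nth_gtn_count //.
exact: sorted_minus_columns_geq.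
Qed.

Lemma entry_le_columns t k : t <= r.*2 -> entry P t k <= N.
Proof.
move=> tr; rewrite leqNgt -ltn_columns_beyond // columns_beyond_bound //.
Qed.

Lemma columns_beyond_sum t e : t <= r.*2 ->
  columns_beyond s t e = \sum_(k < r) (e < entry P t k).
Proof.
move=> tr; under eq_bigr do rewrite -ltn_columns_beyond //.
have le : columns_beyond s t e <= r.
  rewrite leqNgt ltn_columns_beyond // (supported_entry0 (ladder_supported lad)) //.
  exact: leq_addl.
rewrite -[RHS](big_mkord xpredT (fun k => nat_of_bool (k < columns_beyond s t e))).
by rewrite sum_gtn_interval // subn0.
Qed.

Lemma entry_lt t k : t <= r.*2 -> 0 < entry P t k -> entry P t k.+1 < entry P t k.
Proof.
rewrite leq_eqVlt => /orP [/eqP ->|]; last exact: (ladder_lt lad).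
by rewrite (entry_last lad).
Qed.

Lemma columns_beyond_entry t k : t <= r.*2 -> 0 < entry P t k ->
  columns_beyond s t (entry P t k) = k /\ columns_beyond s t (entry P t k).-1 = k.+1.
Proof.
move=> tr pos; have lt := entry_lt tr pos.
split; apply/eqP; rewrite eqn_leq; apply/andP; split.
- by rewrite leqNgt ltn_columns_beyond // ltnn.
- case: k pos {lt} => // k pos; rewrite ltn_columns_beyond // entry_lt //.
  exact: leq_trans pos (entry_nonincreasing lad k tr).
- by rewrite leqNgt ltn_columns_beyond //; lia.
- by rewrite ltn_columns_beyond // prednK.
Qed.

Section Row.
Context (i : 'I_r) (b : bool).
Notation t := (level i b).
Notation x := (entry P t).
Notation y := (entry P t.+1).

(** With [edge_right_of_entry], this tells which of the three cases defining gamma applies: the left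
    spin is + when the entry equals its upper bound in the row above, the right spin is - when it
    equals its lower bound there. *)
Lemma edge_left_of_entry k : 0 < y k -> row_edge s i b (y k) = (y k < x k).
Proof.
move=> pos; have tr := level_lt i b.
have [cb _] := columns_beyond_entry tr pos.
have := row_flux adm i b (entry_le_columns k tr); rewrite cb.
rewrite -(ltn_columns_beyond _ _ (ltnW tr)).
by case: row_edge; lia.
Qed.

Lemma edge_right_of_entry k : 0 < y k -> row_edge s i b (y k).-1 = (x k.+1 == y k).
Proof.
move=> pos; have tr := level_lt i b.
have [_ cb] := columns_beyond_entry tr pos.
have := row_flux adm i b (leq_trans (leq_pred _) (entry_le_columns k tr)).
have := ltn_columns_beyond (y k).-1 k.+1 (ltnW tr).
have := ladder_ge lad k tr.
by case: row_edge; lia.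
Qed.

(** Summing [row_flux] over the edges j >= e, each entry x is counted once for every j with e <= j <
    x, whence the truncated differences. *)
Lemma sum_edges e :
  \sum_(e <= j < N.+1) row_edge s i b j + \sum_(k < r) (y k - e) =
  \sum_(k < r) (x k - e).
Proof.
have tr := level_lt i b.
have sumE t' : t' <= r.*2 ->
    \sum_(e <= j < N.+1) columns_beyond s t' j = \sum_(k < r) (entry P t' k - e).
  move=> tr'; under eq_bigr do rewrite columns_beyond_sum //.
  rewrite exchange_big; apply: eq_bigr => k _; apply: sum_gtn_interval.
  exact: leqW (entry_le_columns k tr').
rewrite -!sumE ?(ltnW tr) // -big_split /=.
by apply: eq_big_nat => j /andP [_ jN]; rewrite (row_flux adm).
Qed.

Local Open Scope ring_scope.

Lemma total_edges :
  (\sum_(0 <= j < N.+1) row_edge s i b j)%N%:Z = \sum_(k < r) ((x k)%:Z - (y k)%:Z).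
Proof.
have s0 (f : nat -> nat) : (\sum_(k < r) (f k - 0) = \sum_(k < r) f k)%N.
  by apply: eq_bigr => k _; rewrite subn0.
have := sum_edges 0; rewrite !s0.
move/(congr1 Posz); rewrite PoszD sumrB => /(canRL (addrK _)) ->.
by rewrite !(big_morph Posz PoszD (erefl _)).
Qed.

(** Take [e = y k] in [sum_edges]: interleaving kills the terms of index above k and makes the
    truncated subtractions exact for the others. This is the charge v_{i,j}. *)
Lemma edges_beyond_entry k : (k < r)%N ->
  (\sum_(y k <= j < N.+1) row_edge s i b j)%N%:Z =
  \sum_(0 <= m < k.+1) ((x m)%:Z - (y m)%:Z).
Proof.
move=> kr; have tr := level_lt i b.
have := sum_edges (y k).
have mono t' : (t' <= r.*2)%N -> {homo entry P t' : m m' / (m <= m')%N >-> (m' <= m)%N}.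
  move=> tr'; apply: homo_leq => [m|m1 m2 m3 h1 h2|m].
  - exact: leqnn.
  - exact: leq_trans h2 h1.
  - exact: (entry_nonincreasing lad).
have trunc t' : (t' <= r.*2)%N -> (entry P t' k.+1 <= y k)%N ->
    (\sum_(m < r) (entry P t' m - y k) = \sum_(0 <= m < k.+1) (entry P t' m - y k))%N.
  move=> tr' le; rewrite -(big_mkord xpredT (fun m => entry P t' m - y k)%N).
  rewrite (@big_cat_nat _ _ _ k.+1) //= [X in (_ + X)%N]big_nat_cond.
  rewrite [X in (_ + X)%N]big1 ?addn0 // => m /andP [/andP [km _] _].
  by apply/eqP; rewrite subn_eq0; apply: leq_trans le; apply: mono.
rewrite !trunc ?(ltnW tr) //; last 2 first.
- exact: (ladder_ge lad).
- exact: (entry_nonincreasing lad).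
move/(congr1 Posz); rewrite PoszD => /(canRL (addrK _)) ->.
rewrite !(big_morph Posz PoszD (erefl _)) -sumrB.
apply: eq_big_nat => m /andP [_ mk].
have yy : (y k <= y m)%N by apply: mono => //; rewrite -ltnS.
have yx : (y m <= x m)%N by apply: (ladder_le lad).
by rewrite -!subzn ?(leq_trans yy yx) //; lia.
Qed.

(** The + edges are the [y k] edges to the right of the entry minus the - ones, and the latter are
    all - edges but those beyond the entry. The isolated [y k] completes the sum over the lower row;
    in a barred row this is w_{i,j}. *)
Lemma edges_before_entry k : (k < r)%N ->
  (\sum_(0 <= j < y k) ~~ row_edge s i b j)%N%:Z =
  \sum_(k <= m < r) ((y m)%:Z - (x m.+1)%:Z).
Proof.
move=> kr; have := total_edges; have := edges_beyond_entry kr.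
have ykN : (y k <= N.+1)%N by apply/leqW/entry_le_columns/level_lt.
move=> Ebeyond; rewrite (big_cat_nat (n := y k)) //=.
rewrite PoszD Ebeyond -[in RHS](big_mkord xpredT (fun m => (x m)%:Z - (y m)%:Z)).
rewrite [in RHS](big_cat_nat (n := k.+1)) //= addrC => /addIr Ebefore.
have : (\sum_(0 <= j < y k) ~~ row_edge s i b j +
        \sum_(0 <= j < y k) row_edge s i b j = y k)%N.
  rewrite -big_split /= (eq_bigr (fun=> 1%N)) => [|j _]; last by case: row_edge.
  by rewrite sum_nat_const_nat muln1 subn0.
move/(congr1 Posz); rewrite PoszD Ebefore => /(canRL (addrK _)) ->.
rewrite !sumrB [in RHS]big_ltn //.
have -> : \sum_(k <= m < r) (x m.+1)%:Z = \sum_(k.+1 <= m < r) (x m)%:Z.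
  have xr : x r = 0%N.
    by apply: supported_entry0 (ladder_supported lad) _; exact: leq_addl.
  by rewrite -[LHS](big_add1 _ _ _ r.+1 xpredT (fun m => (x m)%:Z)) big_nat_recr //= xr addr0.
by ring.
Qed.

End Row.
End Charges.

(** * Degrees of a pattern *)

Lemma big_nat_shift (R : Type) (idx : R) (op : R -> R -> R) (m n : nat) (F : nat -> R) :
  \big[op/idx]_(m <= j < n) F j = \big[op/idx]_(0 <= k < n - m) F (m + k)%N.
Proof.
rewrite -{1}[m]add0n big_addn.
by apply: eq_bigr => k _; rewrite addnC.
Qed.

Lemma pat_v_entry P i k : pat_v P i.+1 (i.+1 + k) =
  \sum_(0 <= m < k.+1) ((entry P i.*2 m)%:Z - (entry P i.*2.+1 m)%:Z).
Proof.
rewrite /pat_v big_nat_shift -addnS addKn.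
by apply: eq_bigr => m _; rewrite entry_even entry_odd.
Qed.

(** Row a_i starts one column after row b_i, hence the index [m.+1]; entries outside the array
    vanish, so the range can end at [r] for every row. *)
Lemma pat_w_entry r P i k : supported r P ->
  pat_w r P i.+1 (i.+2 + k) =
  \sum_(k <= m < r) ((entry P i.+1.*2 m)%:Z - (entry P i.*2.+1 m.+1)%:Z).
Proof.
move=> sP; rewrite /pat_w big_nat_shift [RHS]big_nat_shift.
have le : (r.+1 - (i.+2 + k) <= r - k)%N by lia.
rewrite [RHS](big_cat_nat (leq0n _) le) /=.
rewrite [X in _ = _ + X]big_nat_cond [X in _ = _ + X]big1 ?addr0 => [|m].
  by apply: eq_bigr => m _; rewrite entry_even entry_odd !addSn !addnS addnA.
rewrite andbT => /andP [h1 h2].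
by rewrite !(supported_entry0 sP) //; lia.
Qed.

Section Degree.

Lemma sum_prefix_sums (n : nat) (d : nat -> int) :
  \sum_(0 <= k < n) \sum_(0 <= j < k.+1) d j =
  \sum_(0 <= j < n) d j * (n%:Z - j%:Z).
Proof.
elim: n => [|n IH]; first by rewrite !big_geq.
rewrite big_nat_recr //= IH [RHS]big_nat_recr //= [X in _ + X = _]big_nat_recr //=.
rewrite addrA -big_split /=; congr (_ + _); last by rewrite -natz; ring.
by apply: eq_bigr => j _; rewrite -!natz; ring.
Qed.

Lemma sum_suffix_sums (n : nat) (d : nat -> int) :
  \sum_(0 <= k < n) \sum_(k <= j < n) d j = \sum_(0 <= j < n) d j * (j%:Z + 1).
Proof.
elim: n => [|n IH]; first by rewrite !big_geq.
rewrite [RHS]big_nat_recr //= -IH.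
rewrite (eq_big_nat _ _ (F2 := fun k => \sum_(k <= j < n) d j + d n)); last first.
  by move=> k /andP [_ kn]; rewrite big_nat_recr.
rewrite big_split /= big_nat_recr //= (@big_geq _ _ _ n n) // addr0.
by rewrite sumr_const_nat subn0 -mulr_natr -!natz; ring.
Qed.

Lemma sum_extend (n r : nat) (d : nat -> int) : (n <= r)%N ->
  (forall k, (n <= k)%N -> d k = 0) -> \sum_(0 <= k < n) d k = \sum_(0 <= k < r) d k.
Proof.
move=> nr d0; rewrite [RHS](big_cat_nat (leq0n _) nr) /=.
by rewrite [X in _ + X]big_nat_cond [X in _ + X]big1 ?addr0 // => k /andP [/andP [/d0]].
Qed.

Context (r : nat) (P : pattern) (sP : supported r P).
Notation a m k := (entry P m.*2 k)%:Z.
Notation b m k := (entry P m.*2.+1 k)%:Z.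

Lemma entry_even0 m k : (r - m <= k)%N -> a m k = 0.
Proof. by move=> h; rewrite (supported_entry0 sP) // doubleK -leq_subLR. Qed.

Lemma entry_odd0 m k : (r - m <= k)%N -> b m k = 0.
Proof. by move=> h; rewrite (supported_entry0 sP) //= uphalf_double -leq_subLR. Qed.

Lemma s_a_entry m : (m <= r)%N -> s_a r P m = \sum_(0 <= k < r) a m k.
Proof.
move=> mr; rewrite -(sum_extend (leq_subr m r)) => [|k /entry_even0 //].
rewrite /s_a [LHS]big_nat_shift subSS.
by apply: eq_bigr => k _; rewrite entry_even.
Qed.

Lemma s_b_entry m : (m < r)%N -> s_b r P m.+1 = \sum_(0 <= k < r) b m k.
Proof.
move=> mr; rewrite -(sum_extend (leq_subr m r)) => [|k /entry_odd0 //].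
rewrite /s_b [LHS]big_nat_shift subSS.
by apply: eq_bigr => k _; rewrite entry_odd.
Qed.

Lemma pat_v_last m : (m < r)%N -> pat_v P m.+1 r = s_a r P m - s_b r P m.+1.
Proof.
move=> mr; have -> : pat_v P m.+1 r = pat_v P m.+1 (m.+1 + (r - m.+1)) by rewrite subnKC.
rewrite pat_v_entry -(subSn mr) subSS s_a_entry ?(ltnW mr) // s_b_entry // -sumrB.
apply: sum_extend (leq_subr m r) _ => k h.
by rewrite entry_even0 // entry_odd0.
Qed.

Definition row_degree (i : nat) : int := s_a r P i - 2 * s_b r P i.+1 + s_a r P i.+1.

Definition pat_degree : int :=
  \sum_(i < r) (\sum_(k < r - i) pat_v P i.+1 (i.+1 + k) +
                 \sum_(k < r - i.+1) pat_u r P i.+1 (i.+2 + k)).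

Definition moment (m : nat) : int := \sum_(0 <= k < r) a m k * k%:Z.

(** Prefix sums weight the entry of index j by n - j and suffix sums by j + 1, so first moments
    appear. The shift between rows a and b makes the two moments of the b-row cancel, leaving a
    difference that telescopes in [m]. *)
Lemma row_sum_vu m : (m < r)%N ->
  \sum_(k < r - m) pat_v P m.+1 (m.+1 + k) +
  \sum_(k < r - m.+1) pat_u r P m.+1 (m.+2 + k) =
  (2 * (r%:Z - m%:Z) - 1) * (s_a r P m - s_b r P m.+1) + s_a r P m.+1
  + moment m.+1 - moment m.
Proof.
move=> mr; set n := (r - m)%N.
have nE : n%:Z = r%:Z - m%:Z by rewrite /n -subzn // ltnW.
have -> : \sum_(k < r - m) pat_v P m.+1 (m.+1 + k) =
    \sum_(0 <= j < r) (a m j - b m j) * (n%:Z - j%:Z).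
  rewrite -(big_mkord xpredT (fun k => pat_v P m.+1 (m.+1 + k))).
  under eq_bigr do rewrite pat_v_entry.
  rewrite sum_prefix_sums; apply: sum_extend (leq_subr _ _) _ => k h.
  by rewrite entry_even0 // entry_odd0 // subrr mul0r.
rewrite -(big_mkord xpredT (fun k => pat_u r P m.+1 (m.+2 + k))).
rewrite /pat_u big_split /= sumr_const_nat subn0 pat_v_last //.
have -> : \sum_(0 <= k < r - m.+1) pat_w r P m.+1 (m.+2 + k) =
    \sum_(0 <= j < r) (a m.+1 j - b m j.+1) * (j%:Z + 1).
  have d0 k : (r - m.+1 <= k)%N -> a m.+1 k - b m k.+1 = 0.
    by move=> h; rewrite entry_even0 // entry_odd0 ?subrr //; lia.
  rewrite -(sum_extend (leq_subr m.+1 r)) => [|k /d0 ->]; last by rewrite mul0r.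
  rewrite -sum_suffix_sums; apply: eq_big_nat => k /andP [_ kn].
  rewrite (pat_w_entry _ _ sP) (big_cat_nat (ltnW kn) (leq_subr _ _)) /=.
  rewrite [X in _ + X]big_nat_cond [X in _ + X]big1 ?addr0 // => j.
  by rewrite andbT => /andP [/d0].
have shift : \sum_(0 <= j < r) b m j.+1 * (j%:Z + 1) = \sum_(0 <= j < r) b m j * j%:Z.
  have : \sum_(0 <= j < r.+1) b m j * j%:Z = \sum_(0 <= j < r) b m j * j%:Z.
    by rewrite big_nat_recr //= entry_odd0 ?leq_subr // mul0r addr0.
  rewrite big_nat_recl //= mulr0 add0r => <-.
  by apply: eq_bigr => j _; congr (_ * _); lia.
rewrite s_a_entry ?(ltnW mr) // s_b_entry // s_a_entry // /moment.
have -> : \sum_(0 <= j < r) (a m.+1 j - b m j.+1) * (j%:Z + 1) =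
  \sum_(0 <= j < r) a m.+1 j * j%:Z + \sum_(0 <= j < r) a m.+1 j
  - \sum_(0 <= j < r) b m j.+1 * (j%:Z + 1).
  by rewrite -big_split -sumrB /=; apply: eq_bigr => j _; ring.
rewrite shift.
have -> : \sum_(0 <= j < r) (a m j - b m j) * (n%:Z - j%:Z) =
  n%:Z * (\sum_(0 <= j < r) a m j - \sum_(0 <= j < r) b m j)
  - \sum_(0 <= j < r) a m j * j%:Z + \sum_(0 <= j < r) b m j * j%:Z.
  by rewrite -sumrB mulr_sumr -sumrB -big_split /=; apply: eq_bigr => j _; ring.
have -> : (r - m.+1)%N = n.-1 by lia.
have n1 : n.-1%:Z = n%:Z - 1 by lia.
rewrite -[_ *+ n.-1]mulr_natr natz n1 -nE; ring.
Qed.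

End Degree.

(** * Weights of the rows of a state *)

Section Weights.
Context (r N : nat) (T : nat -> nat) (s : ice_state r N).
Context (adm : admissible T s) (lad : ladder r T (pattern_of s)).
Implicit Types (i : 'I_r) (b : bool).
Notation P := (pattern_of s).

Definition row_charge i (e : nat) : nat := \sum_(e <= j < N.+1) row_edge s i false j.

Definition barred_charge i (e : nat) : nat :=
  row_charge i 0 + \sum_(0 <= j < e.+1) ~~ row_edge s i true j.

Lemma bend_chargeE i : bend_charge s i = row_charge i 0.
Proof.
rewrite /bend_charge /row_charge big_mkord; apply: eq_bigr => e _.
by rewrite /row_edge inord_val.
Qed.

Lemma vertex_charge_row i (c : 'I_N) : vertex_charge s i false c = row_charge i c.+1.
Proof.
rewrite /vertex_charge /edge_charge /row_charge big_geq_mkord /=.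
by apply: eq_bigr => e _; rewrite /row_edge inord_val.
Qed.

Lemma vertex_charge_barred i (c : 'I_N) :
  vertex_charge s i true c = barred_charge i c.
Proof.
rewrite /vertex_charge /edge_charge /barred_charge bend_chargeE; congr addn.
rewrite (big_nat_widen _ _ N.+1) ?big_mkord; last by rewrite ltnS ltnW.
by apply: eq_bigr => e _; rewrite /row_edge inord_val.
Qed.

Lemma level_false i : level i false = i.*2. Proof. exact: addn0. Qed.
Lemma level_true i : level i true = i.*2.+1. Proof. exact: addn1. Qed.

Lemma row_charge_entry i k : (k < r)%N ->
  (row_charge i (entry P i.*2.+1 k))%:Z = pat_v P i.+1 (i.+1 + k).
Proof.
by move=> kr; rewrite pat_v_entry -level_false (edges_beyond_entry adm lad).
Qed.

Lemma row_charge0 i : (row_charge i 0)%:Z = pat_v P i.+1 r.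
Proof.
have sP := ladder_supported lad; have ir := ltn_ord i.
rewrite (pat_v_last sP ir) (s_a_entry sP (ltnW ir)) (s_b_entry sP ir).
by rewrite /row_charge (total_edges adm lad) level_false sumrB !big_mkord.
Qed.

Lemma barred_charge_entry i k : (k < r)%N -> (0 < entry P i.+1.*2 k)%N ->
  (barred_charge i (entry P i.+1.*2 k).-1)%:Z = pat_u r P i.+1 (i.+2 + k).
Proof.
move=> kr pos; rewrite /pat_u (pat_w_entry _ _ (ladder_supported lad)).
rewrite /barred_charge PoszD row_charge0 prednK //; congr (_ + _).
by have := edges_before_entry adm lad i true kr; rewrite level_true.
Qed.

Section VertexWeights.
Context (K : fieldType) (n : nat) (q : K) (g : nat -> K) (z : 'I_r -> K).

(* The weight of a vertex whose lower edge is -, in the column numbered x,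
   without its power of z_i. *)
Definition entry_weight i b (x : nat) : K :=
  let a := if b then barred_charge i x.-1 else row_charge i x in
  match row_edge s i b x, row_edge s i b x.-1 with
  | true, true => if b then 1 else g a
  | true, false => ice_h n q^-1 a
  | false, _ => if b then g a else 1
  end.

(** In all six types the power of z_i depends only on the left spin. The remaining factor is 1 when
    the lower spin is +, except for c_2, whose factor is set apart in [turn_weight]. *)
Definition core_weight i b (c : 'I_N) : K :=
  (if b then (z i)^-1 else z i) ^+ row_edge s i b c.+1 *
  (if ver s (level i b).+1 c then entry_weight i b c.+1 else 1).

Definition turn_weight i b (c : 'I_N) : K :=
  if ~~ row_edge s i b c.+1 && row_edge s i b c then
    ice_delta K n (vertex_charge s i b c) else 1.

Lemma vertex_weightE i b c :
  vertex_weight n q^-1 g z s i b c = core_weight i b c * turn_weight i b c.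
Proof.
have := admissible_vertex adm i b c.
rewrite /core_weight /turn_weight /entry_weight /vertex_weight /vertex_at.
rewrite hor_left_edge hor_right_edge /=.
case: b; rewrite ?vertex_charge_row ?vertex_charge_barred;
case: row_edge; case: row_edge; case: ver; case: ver => //= _;
rewrite ?expr1 ?expr0 ?mulr1 ?mul1r // mulrC //.
Qed.

Section NonzeroRow.
Context (i : 'I_r).
Context (nz : forall b c, core_weight i b c != 0).

Lemma dvdn_charge b (c : 'I_N) :
  row_edge s i b c.+1 -> ~~ row_edge s i b c -> (n %| vertex_charge s i b c)%N.
Proof.
have := nz b c; have := admissible_vertex adm i b c.
rewrite /core_weight /entry_weight /ice_h /ice_delta /=.
case: b; rewrite ?vertex_charge_row ?vertex_charge_barred;
case: row_edge; case: row_edge; case: ver; case: ver => //= _;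
by case: (n %| _)%N; rewrite ?mulr0 ?eqxx.
Qed.

(** The charge grows only at - edges, so at a + edge it is 0 or the charge at the nearest c_1 vertex
    to the left, where h is nonzero. *)
Lemma dvdn_row_charge e : (e <= N)%N -> ~~ row_edge s i false e ->
  (n %| row_charge i e)%N.
Proof.
move=> eN; rewrite -(subKn eN); elim: (N - e)%N (leq_subr e N) => [_|d IH dN].
  by rewrite subn0 /row_charge big_nat1 (admissible_left adm) dvdn0.
have lt : (N - d.+1 < N)%N by lia.
have eS : (N - d = (N - d.+1).+1)%N by lia.
rewrite /row_charge big_ltn => [edge|]; last by lia.
rewrite (negbTE edge) add0n -/(row_charge i _).
case edgeS: (row_edge s i false (N - d.+1).+1).
  by have := @dvdn_charge false (Ordinal lt); rewrite vertex_charge_row => ->.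
by have := IH (ltnW dN); rewrite eS edgeS; apply.
Qed.

(** Here the charge grows only at + edges, read from the bend leftwards. If no c_1 vertex precedes,
    all edges back to the bend are -, so the row-i edge of the bend is + and [dvdn_row_charge]
    applies. *)
Lemma dvdn_barred_charge e : (e <= N)%N -> row_edge s i true e ->
  (n %| barred_charge i e)%N.
Proof.
elim: e => [_|e IH eN] edge; rewrite /barred_charge big_nat_recr //= edge addn0.
  rewrite big_geq // addn0 dvdn_row_charge //.
  by move: edge; rewrite (admissible_bend adm).
rewrite -/(barred_charge i e); case edge': (row_edge s i true e).
  exact: IH (ltnW eN) _.
by have := @dvdn_charge true (Ordinal eN);
  rewrite vertex_charge_barred => ->; rewrite //= edge'.
Qed.

Lemma turn_weight1 b c : turn_weight i b c = 1.
Proof.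
rewrite /turn_weight; case: ifP => // /andP [e1 e2].
case: b e1 e2; rewrite ?vertex_charge_barred ?vertex_charge_row => e1 e2.
  by rewrite /ice_delta dvdn_barred_charge // ltnW.
by rewrite /ice_delta dvdn_row_charge.
Qed.

End NonzeroRow.

(* If a divisibility condition at a vertex of type c_2 fails, then so does one
   at a vertex of type c_1 of the same pair of rows. *)
Lemma prod_vertex_weight i :
  \prod_(b : bool) \prod_(c < N) vertex_weight n q^-1 g z s i b c =
  \prod_(b : bool) \prod_(c < N) core_weight i b c.
Proof.
under eq_bigr => b _ do under eq_bigr => c _ do rewrite vertex_weightE.
case: (boolP [forall b, forall c, core_weight i b c != 0]) => [/forallP nz|].
  apply: eq_bigr => b _; apply: eq_bigr => c _.
  by rewrite turn_weight1 ?mulr1 // => b' c'; have /forallP := nz b'.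
rewrite negb_forall => /existsP [b]; rewrite negb_forall => /existsP [c].
rewrite negbK => /eqP core0.
by rewrite (bigD1 b) //= [RHS](bigD1 b) //= (bigD1 c) //= core0 !mul0r
  [in RHS](bigD1 c) //= core0 !mul0r.
Qed.

Lemma prod_minus_columns t (F : nat -> K) : (t <= r.*2)%N ->
  \prod_(c < N) (if ver s t c then F c.+1 else 1) =
  \prod_(k < r) (if (0 < entry P t k)%N then F (entry P t k) else 1).
Proof.
move=> tr.
transitivity (\prod_(x <- minus_columns s t) F x).
  rewrite big_map big_filter -big_mkcond /=.
  rewrite [RHS](perm_big (enum 'I_N)) ?perm_rev //=.
  by rewrite big_enum_cond.
rewrite (big_nth 0%N) size_minus_columns.
under [LHS]eq_bigr do rewrite -(entry_pattern_of _ adm) //.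
rewrite (big_nat_widen _ _ r) /=; last first.
  by apply: leq_trans (columns_beyond_size adm tr) (leq_subr _ _).
rewrite big_mkord big_mkcond /=; apply: eq_bigr => k _.
by rewrite (ltn_columns_beyond adm).
Qed.

Lemma prod_core_weight i b : \prod_(c < N) core_weight i b c =
  (if b then (z i)^-1 else z i) ^+ (\sum_(1 <= j < N.+1) row_edge s i b j) *
  \prod_(k < r) (if (0 < entry P (level i b).+1 k)%N
    then entry_weight i b (entry P (level i b).+1 k) else 1).
Proof.
rewrite /core_weight big_split /=.
rewrite (prod_minus_columns (fun x => entry_weight i b x)) ; last exact: level_lt.
congr (_ * _); by rewrite big_add1 big_mkord -expr_sum.
Qed.

(** The left edges of the vertices are the edges 1 to N; the power of z_i in the bend weight
    accounts for edge 0 of both rows, so the exponent becomes a difference of total numbers of -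
    edges. *)
Lemma prod_row_weight i : z i != 0 ->
  (\prod_(b : bool) \prod_(c < N) core_weight i b c) * bend_weight g z s i =
  z i ^ (\sum_(k < r) ((entry P i.*2 k)%:Z - (entry P i.*2.+1 k)%:Z)
         - \sum_(k < r) ((entry P i.*2.+1 k)%:Z - (entry P i.+1.*2 k)%:Z)) *
  \prod_(k < r) (if (0 < entry P i.*2.+1 k)%N
      then entry_weight i false (entry P i.*2.+1 k) else 1) *
  (if row_edge s i false 0 then g (2 * row_charge i 0)%N else 1) *
  \prod_(k < r) (if (0 < entry P i.+1.*2 k)%N
      then entry_weight i true (entry P i.+1.*2 k) else 1).
Proof.
move=> z0; have := total_edges adm lad i false; have := total_edges adm lad i true.
rewrite level_true level_false -doubleS => <- <-.
rewrite !big_bool /= !prod_core_weight /bend_weight hor_ord0 bend_chargeE.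
rewrite !(@big_ltn _ _ _ 0 N.+1) // (admissible_bend adm) level_true level_false -doubleS.
set A := (\sum_(1 <= j < _) row_edge s i true j)%N.
set B := (\sum_(1 <= j < _) row_edge s i false j)%N.
rewrite exprVn; case: row_edge; rewrite /= ?add0n ?PoszD ?addrA.
  rewrite expfzDr // expfzDr // expr1z -exprnN -!exprnP.
  move: (z i ^- A) (z i ^+ B) (z i) (g _) => a c d e.
  by move: (\prod_(k < r) _) (\prod_(k < r) _) => X Y; ring.
rewrite mulr1 opprD addrA expfzDr // expfzDr // -!exprnN -!exprnP expr1.
move: (z i ^- A) (z i ^+ B) (z i)^-1 => a c d.
by move: (\prod_(k < r) _) (\prod_(k < r) _) => X Y; ring.
Qed.

End VertexWeights.
End Weights.

(** * Comparison with the Gauss sum weights *)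

Section GaussWeights.
Context (r N : nat) (T : nat -> nat) (s : ice_state r N).
Context (adm : admissible T s) (lad : ladder r T (pattern_of s)).
Implicit Types (i : 'I_r) (b : bool).
Notation P := (pattern_of s).
Context (K : fieldType) (n : nat) (q : K) (gs : int -> K) (z : 'I_r -> K).
Context (q0 : q != 0) (n_odd : odd n).
Notation g := (fun a : nat => q^-1 * gs a%:Z).

Lemma gamma_b_entry i k : (i + k < r)%N ->
  gamma_b r n q gs P i.+1 (i.+1 + k) = q ^ pat_v P i.+1 (i.+1 + k) *
    (if (0 < entry P i.*2.+1 k)%N
     then entry_weight s n q g i false (entry P i.*2.+1 k)
     else g (2 * row_charge s i 0)%N).
Proof.
move=> ikr; have kr : (k < r)%N := leq_ltn_trans (leq_addl _ _) ikr.
have tr : (i.*2 < r.*2)%N by rewrite ltn_double.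
have pos : (0 < entry P i.*2 k)%N := ladder_gt0 lad ikr.
have le := ladder_le lad k tr; have ge := ladder_ge lad k tr.
have q_pow a : q ^ (a - 1) = q ^ a * q^-1 by rewrite expfzDr.
have ch : (row_charge s i (entry P i.*2.+1 k))%:Z = pat_v P i.+1 (i.+1 + k).
  exact: (row_charge_entry adm lad).
have eL := edge_left_of_entry adm lad (i := i) (b := false) (k := k).
have eR := edge_right_of_entry adm lad (i := i) (b := false) (k := k).
rewrite level_false in eL eR.
rewrite /gamma_b -entry_odd -addnS -[pa P _ (i.+1 + k)]entry_even.
rewrite -[pa P _ _]entry_even.
case: eqP => [yx|/eqP yx].
  by rewrite yx pos in eL *; rewrite /entry_weight eL // ltnn mulr1.
case: eqP => [yx'|/eqP yx'].
  case: ltnP => [y0|].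
    (* For j = r the lower bound is a_{i-1,r+1} = 0, so a positive entry attaining its lower bound
       has j < r and its Gauss sum is not doubled. *)
    have jr : (i.+1 + k)%N != r.
      apply: contraTneq y0 => jr; rewrite yx' -leqNgt leqn0; apply/eqP.
      by apply: supported_entry0 (ladder_supported lad) _; rewrite doubleK addnS -addSn jr.
    rewrite /entry_weight eL // eR // yx' eqxx -yx' ltn_neqAle yx le /=.
    by rewrite ch (negbTE jr) mul1r q_pow mulrA.
  rewrite leqn0 => /eqP y0.
  (* For j < r the lower bound a_{i-1,j+1} is positive, so a zero entry is b_{i,r}; its v_{i,r} is
     the charge at the bend. *)
  have jr : (i.+1 + k)%N = r.
    apply/eqP; rewrite eqn_leq ikr leqNgt; apply/negP => jr.
    by have := @ladder_gt0 _ _ _ lad i k.+1; rewrite -yx' y0 addnS -addSn => /(_ jr).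
  by rewrite jr eqxx PoszM (row_charge0 adm lad) q_pow mulrA.
have x'y : (entry P i.*2 k.+1 < entry P i.*2.+1 k)%N by rewrite ltn_neqAle eq_sym yx' ge.
have y0 := leq_ltn_trans (leq0n _) x'y.
have yltx : (entry P i.*2.+1 k < entry P i.*2 k)%N by rewrite ltn_neqAle yx le.
rewrite x'y yltx y0 /entry_weight eL // eR // yltx
  [_ == entry P _ k]eq_sym (negbTE yx') /ice_h /ice_delta.
rewrite /phi_pow -ch /=.
have -> : (n%:Z %| (1 + ((i.+1 + k)%N == r))%N%:Z * (row_charge s i (entry P i.*2.+1 k))%:Z)%Z
   = (n %| row_charge s i (entry P i.*2.+1 k))%N.
  rewrite -PoszM dvdzE /=; case: eqP => _; rewrite ?mul1n //.
  by rewrite Gauss_dvdr // coprimen2.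
by case: (n %| _)%N; rewrite ?mulr1 ?mulr0.
Qed.

Lemma gamma_a_entry i k : (i.+1 + k < r)%N ->
  gamma_a r n q gs P i.+1 (i.+2 + k) = q ^ pat_u r P i.+1 (i.+2 + k) *
    entry_weight s n q g i true (entry P i.+1.*2 k).
Proof.
move=> ikr; have kr : (k < r)%N := leq_ltn_trans (leq_addl _ _) ikr.
have tr : (i.*2.+1 < r.*2)%N by move: ikr; lia.
have pos : (0 < entry P i.+1.*2 k)%N := ladder_gt0 lad ikr.
have le := ladder_le lad k tr; have ge := ladder_ge lad k tr.
rewrite -doubleS in le ge.
have q_pow a : q ^ (a - 1) = q ^ a * q^-1 by rewrite expfzDr.
have ch := barred_charge_entry adm lad kr pos.
have eL := edge_left_of_entry adm lad (i := i) (b := true) (k := k).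
have eR := edge_right_of_entry adm lad (i := i) (b := true) (k := k).
rewrite level_true -doubleS in eL eR.
rewrite /gamma_a -entry_even -[pb P _ _.-1]entry_odd addSn -addnS -entry_odd.
rewrite /entry_weight eL // eR //.
case: eqP => [yx|/eqP yx].
  have -> : (entry P i.+1.*2 k < entry P i.*2.+1 k)%N = false by rewrite yx ltnn.
  by rewrite ch q_pow -addSnnS mulrA.
have yltx : (entry P i.+1.*2 k < entry P i.*2.+1 k)%N by rewrite ltn_neqAle yx le.
rewrite yltx [entry P _ k.+1 == _]eq_sym; case: eqP => [yx'|/eqP yx']; first by rewrite mulr1.
have x'y : (entry P i.*2.+1 k.+1 < entry P i.+1.*2 k)%N by rewrite ltn_neqAle eq_sym yx' ge.
rewrite x'y /= -addSnnS -ch dvdzE /= /phi_pow /ice_h /ice_delta.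
by case: (n %| _)%N; rewrite ?mulr1 ?mulr0.
Qed.

(** Only the last entry of a b-row can vanish, and it does exactly when the row-i edge of the bend
    is -; the bend factor [c] thus becomes the factor of that entry. *)
Lemma prod_row_entries i (F : nat -> K) (c : K) :
  \prod_(k < r) (if (0 < entry P i.*2.+1 k)%N then F (entry P i.*2.+1 k) else 1) *
  (if row_edge s i false 0 then c else 1) =
  \prod_(k < r - i) (if (0 < entry P i.*2.+1 k)%N then F (entry P i.*2.+1 k) else c).
Proof.
have ir := ltn_ord i; have tr : (i.*2 < r.*2)%N by rewrite ltn_double.
have -> : \prod_(k < r) (if (0 < entry P i.*2.+1 k)%N then F (entry P i.*2.+1 k) else 1) =
    \prod_(k < r - i) (if (0 < entry P i.*2.+1 k)%N then F (entry P i.*2.+1 k) else 1).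
  pose G k := if (0 < entry P i.*2.+1 k)%N then F (entry P i.*2.+1 k) else 1.
  rewrite -(big_mkord xpredT G) (big_cat_nat (leq0n _) (leq_subr i r)) /=.
  rewrite [X in _ * X]big_nat_cond [X in _ * X]big1 ?mulr1 ?big_mkord // => k.
  rewrite andbT => /andP [h _].
  by rewrite /G (supported_entry0 (ladder_supported lad)) //= uphalf_double; lia.
have [m rm] : exists m, (r - i = m.+1)%N by exists (r - i.+1)%N; lia.
have edge : row_edge s i false 0 = ~~ (0 < entry P i.*2.+1 m)%N.
  have := row_flux adm i false (leq0n N).
  rewrite level_false (columns_beyond_even adm (ltnW ir)) rm.
  have := columns_beyond_size adm tr; rewrite /= uphalf_double rm => le.
  by rewrite -(ltn_columns_beyond adm) //; case: row_edge; lia.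
rewrite rm !big_ord_recr /= edge -mulrA; congr (_ * _).
  apply: eq_bigr => k _; have -> // : (0 < entry P i.*2.+1 k)%N.
  apply: leq_trans (ladder_ge lad _ tr); apply: (ladder_gt0 lad).
  by have := ltn_ord k; lia.
by case: ltnP; rewrite ?mul1r ?mulr1.
Qed.

Lemma prod_barred_entries i (F : nat -> K) :
  \prod_(k < r) (if (0 < entry P i.+1.*2 k)%N then F (entry P i.+1.*2 k) else 1) =
  \prod_(k < r - i.+1) F (entry P i.+1.*2 k).
Proof.
pose G k := if (0 < entry P i.+1.*2 k)%N then F (entry P i.+1.*2 k) else 1.
rewrite -(big_mkord xpredT G) (big_cat_nat (leq0n _) (leq_subr i.+1 r)) /=.
rewrite [X in _ * X]big_nat_cond [X in _ * X]big1 ?mulr1 => [|k].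
  rewrite big_mkord; apply: eq_bigr => k _; rewrite /G (ladder_gt0 lad) //.
  by have := ltn_ord k; lia.
rewrite andbT => /andP [h _].
by rewrite /G (supported_entry0 (ladder_supported lad)) //= doubleK; lia.
Qed.

Lemma row_degreeE i : row_degree r P i =
  \sum_(k < r) ((entry P i.*2 k)%:Z - (entry P i.*2.+1 k)%:Z) -
  \sum_(k < r) ((entry P i.*2.+1 k)%:Z - (entry P i.+1.*2 k)%:Z).
Proof.
have sP := ladder_supported lad; have ir := ltn_ord i.
rewrite /row_degree (s_a_entry sP ir) (s_a_entry sP (ltnW ir)) (s_b_entry sP ir).
by rewrite !big_mkord !sumrB; ring.
Qed.

Lemma pat_G_rows : pat_G r n q gs P =
  \prod_(i < r) ((\prod_(k < r - i) gamma_b r n q gs P i.+1 (i.+1 + k)) *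
                 (\prod_(k < r - i.+1) gamma_a r n q gs P i.+1 (i.+2 + k))).
Proof.
rewrite /pat_G mulrC big_split /= !big_add1 /= !big_mkord.
by congr (_ * _); apply: eq_bigr => i _; rewrite big_nat_shift big_mkord.
Qed.

Lemma ice_weight_pat_G : (forall i, z i != 0) ->
  q ^ pat_degree r P * ice_weight n q^-1 g z s =
  (\prod_(i < r) z i ^ row_degree r P i) * pat_G r n q gs P.
Proof.
move=> z0; rewrite pat_G_rows /ice_weight -!big_split /=.
have q_sum m (F : 'I_m -> int) : q ^ (\sum_(k < m) F k) = \prod_(k < m) q ^ F k.
  by apply: (big_morph (fun a => q ^ a)) => // a b; rewrite expfzDr.
rewrite q_sum -!big_split /=; apply: eq_bigr => i _.
rewrite (prod_vertex_weight adm) (prod_row_weight adm lad) // -row_degreeE.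
rewrite expfzDr // !q_sum.
rewrite -[X in _ * (X * _)]mulrA (prod_row_entries i (entry_weight s n q g i false)).
rewrite (prod_barred_entries i (entry_weight s n q g i true)).
rewrite -[X in _ * X = _]mulrA [LHS]mulrCA mulrACA -!big_split /=.
congr (_ * (_ * _)); apply: eq_bigr => k _.
  by rewrite gamma_b_entry //; have := ltn_ord k; lia.
by rewrite gamma_a_entry //; have := ltn_ord k; lia.
Qed.

End GaussWeights.

(** * The vector k(P) *)

Section WeightVector.
Context (r : nat) (T : nat -> nat) (P : pattern).
Context (sP : supported r P) (top : forall m, (m < r)%N -> entry P 0 m = T m.+1).

Lemma twice_pat_degree : 2 * pat_degree r P =
  \sum_(0 <= m < r) (2 * (r%:Z - m%:Z) - 1) * (row_degree r P m + (T m.+1)%:Z).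
Proof.
(* [f] is chosen so that twice the degree of the m-th pair of rows is its [row_degree] term plus
   [f m - f m.+1]; [f 0] is the contribution of the top row. *)
pose f m := (2 * (r%:Z - m%:Z) - 1) * s_a r P m - 2 * moment r P m.
have f0 : f 0%N = \sum_(0 <= m < r) (2 * (r%:Z - m%:Z) - 1) * (T m.+1)%:Z.
  rewrite /f (s_a_entry sP) // /moment !mulr_sumr -sumrB; apply: eq_big_nat => m /andP [_ mr].
  by rewrite double0 top //; ring.
have fr : f r = 0.
  rewrite /f (s_a_entry sP) // /moment big_nat_cond big1 ?mulr0 => [|m _].
    by rewrite big1 ?mulr0 ?subrr // => m _; rewrite (entry_even0 sP) ?subnn ?mul0r.
  by rewrite (entry_even0 sP) ?subnn.
under [RHS]eq_bigr do rewrite mulrDr.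
have f_tel : f 0%N = \sum_(0 <= m < r) (f m - f m.+1).
  apply: (can_inj opprK); rewrite -sumrN; under eq_bigr do rewrite opprB.
  by rewrite telescope_sumr // fr sub0r.
rewrite big_split /= -f0 f_tel -big_split /= /pat_degree mulr_sumr.
rewrite [RHS]big_mkord; apply: eq_bigr => m _.
rewrite (row_sum_vu sP) // /f /row_degree.
have -> : m.+1%:Z = m%:Z + 1 by lia.
by ring.
Qed.

(** The integer sum defining k_{i+1}(P), before the halving for k_1. With [i] counted from 0,
    [row_degree r P (r - j.+1)] is wt_{j+1}(P) and [T (r - j)] is L_{j+1}. *)
Definition tail_degree (i : nat) : int :=
  \sum_(i <= j < r) (row_degree r P (r - j.+1) + (T (r - j)%N)%:Z).

Lemma has_kvec_tail (k : {ffun 'I_r -> nat}) (i : 'I_r) : has_kvec T P k ->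
  tail_degree i = if i == 0%N :> nat then 2 * (k i)%:Z else (k i)%:Z.
Proof.
move/forallP/(_ i)/eqP; rewrite /kvec big_add1 /=.
have -> : \sum_(i <= j < r) (pat_wt r P j.+1 + (T (r.+1 - j.+1)%N)%:Z) = tail_degree i.
  apply: eq_big_nat => j /andP [_ jr]; rewrite /pat_wt subSS /row_degree.
  by have -> : ((r - j.+1).+1 = r - j)%N by lia.
rewrite eqSS; case: eqP => _ E; apply: (@intr_inj rat).
  by rewrite intrM -[RHS]/(2 * (k i)%:R) -E; field.
by rewrite E.
Qed.

Lemma pat_degree_kvec (k : {ffun 'I_r -> nat}) : has_kvec T P k ->
  pat_degree r P = \sum_(i < r) (k i)%:Z.
Proof.
move=> hk; apply: (@mulfI _ (2 : int)) => //.
have -> : 2 * \sum_(i < r) (k i)%:Z = 2 * \sum_(0 <= i < r) tail_degree i - tail_degree 0.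
  have -> : tail_degree 0 = \sum_(0 <= i < r) (if i == 0%N then tail_degree i else 0).
    have [r0|r0] := posnP r; first by rewrite /tail_degree r0 !big_geq.
    rewrite [RHS]big_ltn //= [X in _ + X]big_nat_cond [X in _ + X]big1 ?addr0 // => i.
    by rewrite andbT; case: i.
  rewrite !mulr_sumr -sumrB big_mkord; apply: eq_bigr => i _.
  by rewrite (has_kvec_tail i hk); case: eqP => _; ring.
(* The j-th term lies in the tails 0 to j; doubling and removing [tail_degree 0] once gives it the
   coefficient 2(j + 1) - 1, which is that of [twice_pat_degree] for m = r - 1 - j. *)
rewrite sum_suffix_sums mulr_sumr -sumrB twice_pat_degree big_nat_rev /= add0n.
apply: eq_big_nat => j /andP [_ jr].
have -> : ((r - j.+1).+1 = r - j)%N by lia.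
have -> : (r - j.+1)%N%:Z = r%:Z - j%:Z - 1 by lia.
by ring.
Qed.

Lemma prod_tail_quotients (K : fieldType) (Z : nat -> K) (S : nat -> int) (n : nat) :
  (forall j, Z j != 0) ->
  \prod_(0 <= j < n.+1) (if j == 0%N then Z j ^ S j else Z j ^ S j / Z j.-1 ^ S j) =
  (\prod_(0 <= j < n) Z j ^ (S j - S j.+1)) * Z n ^ S n.
Proof.
move=> Z0; elim: n => [|n IH]; first by rewrite big_nat1 big_geq // mul1r.
rewrite big_nat_recr //= {}IH [in RHS]big_nat_recr //= -!mulrA; congr (_ * _).
by rewrite expfzDr // invr_expz -mulrA [_ * (Z n.+1 ^ _)]mulrC.
Qed.

(** Abel summation in multiplicative form: quotients of neighbouring z's turn the tails into their
    differences, each a single wt_j + L_j. The square at the first index compensates the halving in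
    k_1. *)
Lemma prod_kvec (K : fieldType) (z c : 'I_r -> K) (k : {ffun 'I_r -> nat}) :
  (forall i, z i != 0) -> has_kvec T P k ->
  (forall i : 'I_r, i = 0%N :> nat -> c i = z (rev_ord i) ^+ 2) ->
  (forall i j : 'I_r, j = i.+1 :> nat -> c j = z (rev_ord j) / z (rev_ord i)) ->
  \prod_(i < r) c i ^+ k i = \prod_(i < r) z i ^ (row_degree r P i + (T i.+1)%:Z).
Proof.
move=> z0 hk c0 cS; have [r0|r0] := posnP r.
  by rewrite !big1 // => -[i ir]; exfalso; rewrite r0 in ir.
(* The value 1 outside the range keeps [Z] nonzero everywhere. *)
pose Z j := if insub j is Some i then z (rev_ord i) else 1 : K.
have ZE (i : 'I_r) : Z i = z (rev_ord i) by rewrite /Z valK.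
have Z0 j : Z j != 0 by rewrite /Z; case: insub => [i|]; rewrite ?oner_eq0.
have [m rm] : exists m, r = m.+1 by exists r.-1; rewrite prednK.
have := prod_tail_quotients tail_degree m Z0.
rewrite -rm => E.
transitivity (\prod_(0 <= j < r) (if j == 0%N then Z j ^ tail_degree j
                else Z j ^ tail_degree j / Z j.-1 ^ tail_degree j)).
  rewrite big_mkord; apply: eq_bigr => i _; rewrite (has_kvec_tail i hk) ZE.
  case: eqP => [i0|/eqP i0].
    by rewrite c0 // -exprM exprnP PoszM.
  have ir : (i.-1 < r)%N by rewrite (leq_ltn_trans (leq_pred i)).
  have -> : Z i.-1 = z (rev_ord (Ordinal ir)) by rewrite -ZE.
  by rewrite (cS (Ordinal ir) i) /= ?prednK ?lt0n // -!exprnP expr_div_n.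
rewrite {}E.
have tail_last : tail_degree r = 0 by rewrite /tail_degree big_geq.
have -> : Z m ^ tail_degree m = Z m ^ (tail_degree m - tail_degree m.+1).
  by rewrite -rm tail_last subr0.
rewrite -[LHS](big_nat_recr _ _ (fun j => Z j ^ (tail_degree j - tail_degree j.+1))) //=.
rewrite -rm [LHS]big_mkord [RHS](reindex_inj rev_ord_inj) /=.
apply: eq_bigr => i _; rewrite ZE; congr (_ ^ _).
rewrite /tail_degree big_ltn // [X in _ - X]/= addrK.
by have -> : ((r - i.+1).+1 = r - i)%N by have := ltn_ord i; lia.
Qed.

End WeightVector.

(** * Evaluation of the Dirichlet series *)

Section ComplexPowers.
Context (R : realType).
Implicit Types (x : R) (s t : R[i]).

Lemma cpowD x s t : 0 < x -> cpow x (s + t) = cpow x s * cpow x t.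
Proof.
move=> x0; case: s t => [a b] [c d]; rewrite /cpow /= powRD; last first.
  by rewrite (gt_eqF x0) implybT.
rewrite mulrDl cosD sinD rmorphM /= mulrACA; congr (_ * _).
by apply/eqP; rewrite eq_complex /=; apply/andP; split; apply/eqP; ring.
Qed.

Lemma cpow0 x : cpow x 0 = 1.
Proof. by rewrite /cpow /= powRr0 mul0r cos0 sin0 mul1r. Qed.

Lemma cpow1 x : 0 < x -> cpow x 1 = x%:C.
Proof. by move=> x0; rewrite /cpow /= powRr1 ?ltW // mul0r cos0 sin0 mulr1. Qed.

Lemma cpowMn x (k : nat) s : 0 < x -> cpow x (k%:R * s) = cpow x s ^+ k.
Proof.
move=> x0; elim: k => [|k IH]; first by rewrite mul0r cpow0.
by rewrite -natr1 mulrDl mul1r cpowD // IH exprSr.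
Qed.

Lemma cpow_neq0 x s : 0 < x -> cpow x s != 0.
Proof.
move=> x0; apply/eqP => e; have := cpowD s (- s) x0.
by rewrite subrr cpow0 e mul0r => /eqP; rewrite oner_eq0.
Qed.

End ComplexPowers.

(** A nonzero factor does not change the support, and a sum with infinite support is 0 by
    convention, so finiteness need not be assumed. *)
Lemma mulr_fsum (R : idomainType) (I : choiceType) (c : R) (A : set I) (F : I -> R) :
  c != 0 -> c * \sum_(i \in A) F i = \sum_(i \in A) c * F i.
Proof.
move=> c0; have [fin|inf] := pselect (finite_set (A `&` F @^-1` [set~ 0])).
  exact: full_fsbig_distrr.
rewrite !fsbig_dflt ?mulr0 //.
suff -> : (fun i => c * F i) @^-1` [set~ 0] = F @^-1` [set~ 0] by [].
apply/seteqP; split=> i /= h; first by move=> e; apply: h; rewrite e mulr0.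
by move/eqP; rewrite mulf_eq0 (negbTE c0) => /eqP.
Qed.

Lemma sum_finite_fsbig (R : pzRingType) (I : finType) (C : pred I) (F : I -> R) :
  \sum_(i | C i) F i = \sum_(i \in [set i | C i]) F i.
Proof. by apply: bigfs => [|i _]; rewrite ?index_enum_uniq // mem_index_enum. Qed.

Section LambdaRho.
Context (r : nat) (l : 'I_r -> nat).
Local Open Scope nat_scope.

Lemma leq_lam j : lam l j.+1 <= lam l j.
Proof.
rewrite /lam big_mkcond [leqRHS]big_mkcond; apply: leq_sum => k _.
by case: ifP => // h; rewrite (leq_trans h) //; lia.
Qed.

Lemma ltn_lamrho j : j <= r -> lamrho l j.+1 < lamrho l j.
Proof. by move=> jr; have := leq_lam j; rewrite /lamrho; lia. Qed.

Lemma lamrho_gt0 : 0 < lamrho l r.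
Proof. by rewrite /lamrho subSnn addn1. Qed.

End LambdaRho.

Lemma residue_card_gt0 (F : fieldType) (O : set F) (p : F) (q : nat) :
  O !=set0 -> (residue_ring O p #= `I_q)%card -> (0 < q)%N.
Proof.
move=> [x Ox]; case: q => //; rewrite II0 card_eq0 => /eqP R0.
have : residue_ring O p (coset O p x) by exists x.
by rewrite R0.
Qed.

(** Here [c i] stands for q^{1-2s_i} and [d i] for |p|^{2 k_i s_i}: dividing by the latter turns the
    power of q relating G(P) to the ice weight into powers of the z_i. *)
Lemma pat_G_ice_weight (K : fieldType) (r N n : nat) (q : K) (gs : int -> K)
  (T : nat -> nat) (z c d : 'I_r -> K) (s : ice_state r N) (k : {ffun 'I_r -> nat}) :
  odd n -> q != 0 -> (forall i, z i != 0) -> (forall i, d i != 0) ->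
  (forall i, d i * c i ^+ k i = q ^+ k i) ->
  (forall i : 'I_r, i = 0%N :> nat -> c i = z (rev_ord i) ^+ 2) ->
  (forall i j : 'I_r, j = i.+1 :> nat -> c j = z (rev_ord j) / z (rev_ord i)) ->
  admissible T s -> ladder r T (pattern_of s) -> has_kvec T (pattern_of s) k ->
  pat_G r n q gs (pattern_of s) / \prod_(i < r) d i =
  (\prod_(i < r) z i ^+ T i.+1) *
    ice_weight n q^-1 (fun a : nat => q^-1 * gs a%:Z) z s.
Proof.
move=> n_odd q0 z0 d0 dc c0 cS adm lad hk.
have sP := ladder_supported lad; have top := ladder_top lad.
have := ice_weight_pat_G adm lad gs q0 n_odd z0.
rewrite (pat_degree_kvec sP top hk).
have -> : q ^ (\sum_(i < r) (k i)%:Z) = \prod_(i < r) q ^+ k i.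
  by apply: (big_morph (fun a : int => q ^ a)) => // a b; rewrite expfzDr.
have -> : \prod_(i < r) q ^+ k i =
    (\prod_(i < r) d i) * ((\prod_(i < r) z i ^ row_degree r (pattern_of s) i) *
                          \prod_(i < r) z i ^+ T i.+1).
  rewrite -(eq_bigr _ (fun i _ => dc i)) big_split /=; congr (_ * _).
  rewrite (prod_kvec z0 hk c0 cS) -big_split /=.
  by apply: eq_bigr => i _; rewrite expfzDr.
have Z0 : \prod_(i < r) z i ^ row_degree r (pattern_of s) i != 0.
  by apply/prodf_neq0 => i _; rewrite expfz_neq0.
have D0 : \prod_(i < r) d i != 0 by apply/prodf_neq0.
move=> E; apply: (mulfI Z0); rewrite mulrA -E mulrAC (mulrAC (\prod_(i < r) d i)).
by rewrite divff // mul1r -mulrA.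
Qed.

Theorem theorem4 (R : realType) (n r : nat) (hn : odd n) (hr : (1 <= r)%N)
  (F : fieldExtType rat)
  (hF : exists zeta : F, (2 * n).-primitive_root zeta)
  (m : nat) (S : 'I_m -> absval R F) (hS : admissible_places S)
  (hPID : is_PID (S_integers S))
  (Fv : forall v, completion (S v))
  (p : F) (hp : prime_element (S_integers S) p)
  (q : nat) (hq : (residue_ring (S_integers S) p #= `I_q)%card)
  (eps : F -> R[i]) (heps : mu_embedding n eps)
  (psi : FS Fv -> R[i]) (hpsi : additive_character psi)
  (hcond : conductor_is (S_integers S) psi)
  (l : 'I_r -> nat)
  (Psi : ('I_r -> FS_units Fv) -> R[i])
  (s : 'I_r -> R[i])
  (z : 'I_r -> R[i]) (hz : forall i, z i != 0)
  (hz1 : forall i : 'I_r, i = 0%N :> nat ->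
     cpow (q%:R : R) (1 - 2 * s i) = z (rev_ord i) ^+ 2)
  (hzi : forall i j : 'I_r, j = i.+1 :> nat ->
     cpow (q%:R : R) (1 - 2 * s j) = z (rev_ord j) / z (rev_ord i)) :
  let gs := gauss_sum (S_integers S) p q n eps psi in
  Z_series hp n q gs Psi l s =
  (\prod_(i < r) z i ^+ lamrho l i.+1) *
  \sum_(k \in [set: {ffun 'I_r -> nat}])
    (Psi (FS_pow Fv hp k) *
     \sum_(st : ice_state r (lamrho l 1) |
             admissible (lamrho l) st && has_kvec (lamrho l) (pattern_of st) k)
        ice_weight n (q%:R^-1) (fun a : nat => q%:R^-1 * gs a%:Z) z st).
Proof.
move=> gs; have q_gt0 : (0 < q)%N.
  by apply: residue_card_gt0 hq; exists p; exact: (prime_element_in hp).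
have qR : 0 < q%:R :> R by rewrite ltr0n.
have q0 : q%:R != 0 :> R[i] by rewrite pnatr_eq0 -lt0n.
have lam_lt j : (1 <= j < r)%N -> (lamrho l j.+1 < lamrho l j)%N.
  by case/andP => _ jr; rewrite ltn_lamrho // ltnW.
have lam_le j : (1 <= j <= r)%N -> (lamrho l j <= lamrho l 1)%N.
  elim: j => // j IH /andP [_ jr]; have [-> //|j0] := posnP j.
  by apply: leq_trans (ltnW (lam_lt j _)) (IH _); lia.
have lam_gt0 : (0 < r)%N -> (0 < lamrho l r)%N by move=> _; exact: lamrho_gt0.
rewrite /Z_series mulr_fsum; last by apply/prodf_neq0 => i _; rewrite expf_neq0.
apply: eq_fsbigr => k _; rewrite [RHS]mulrCA [LHS]mulrAC [LHS]mulrC; congr (_ * _).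
rewrite /H_coef.
(* The number of columns is by definition the largest part of lambda + rho, whence [erefl]. *)
rewrite (reindex_fsbig _ _ _ _ (pattern_of_bij (T := lamrho l)
  (fun P => has_kvec (lamrho l) P k) (fun=> erefl) lam_lt lam_gt0)).
rewrite -sum_finite_fsbig mulr_suml mulr_sumr; apply: eq_bigr => st /andP [adm hk].
have lad := pattern_of_ladder adm lam_le lam_lt lam_gt0.
apply: (pat_G_ice_weight gs hn q0 hz _ _ hz1 hzi adm lad hk) => i.
  exact: cpow_neq0.
(* It remains to see that q^{2 s_i} q^{1 - 2 s_i} = q, raised to the power k_i. *)
have -> : 2 * (k i)%:R * s i = (k i)%:R * (2 * s i) :> R[i] by ring.
by rewrite cpowMn // -exprMn -cpowD // addrC subrK cpow1 // rmorph_nat.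
Qed.
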